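(* Let $\alpha$ be a partition all of whose parts are at least $2$, let $p=(p_1,\dots,p_{\ell(\alpha)-1},0)$ be the overlapping partition of the ribbon $R_\alpha^p$, and let $\nu$ be a partition of $|\alpha|$. Then $c_{R_\alpha^p}^{\nu}>0$ if and only if $$\nu\in[\alpha,(|\alpha|-p_1,p_1)]\quad\text{and}\quad \nu_i\le \sum_{q=i}^{\ell(\alpha)}\alpha_q-p_i\ \text{ for } 1\le i\le \ell(p).$$ In particular, when $\ell(p)=\ell(\alpha)-1$, that is, $p_i=\ell(\alpha)-i$ for $1\le i\le \ell(\alpha)$, there exists a standard Young tableau of shape $\nu$ with descent set $\mathcal{S}(\alpha)$ if and only if these conditions hold.
   Context: A partition $\alpha=(\alpha_1\ge\dots\ge\alpha_{\ell(\alpha)}>0)$ has length $\ell(\alpha)$ and size $|\alpha|=\sum\alpha_i$; parts with index beyond the length are $0$. Young diagrams are drawn in English convention. A ribbon is a skew Young diagram containing no $2\times 2$ square. For a composition $\alpha$, $R_\alpha$ denotes a ribbon whose rows, from top to bottom, have lengths $\alpha_1,\dots,\alpha_{\ell(\alpha)}$, where consecutive rows share at most one column and non-consecutive rows share no column; it is connected iff every pair of consecutive rows shares exactly one column. If $\alpha$ is a partition with all parts $\ge 2$, the overlapping partition of $R_\alpha$ is $p=(p_1,\dots,p_{\ell(\alpha)-1},0)$, where $p_i$ is the number of columns of length two contained in the last $\ell(\alpha)-i+1$ rows of $R_\alpha$; $\ell(p)$ denotes the number of nonzero parts of $p$. The ribbon is determined by the pair $(\alpha,p)$ and is denoted $R_\alpha^p$.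 For a skew shape $A$, the Littlewood–Richardson coefficients $c_A^\nu$ are defined by $s_A=\sum_\nu c_A^\nu s_\nu$ (expansion of the skew Schur function in Schur functions). $\preceq$ is the dominance order on partitions of the same size, and $[\lambda,\mu]=\{\nu:\lambda\preceq\nu\preceq\mu\}$. For a standard Young tableau $U$ with $n$ boxes, its descent set is the set of $i\in\{1,\dots,n-1\}$ such that $i+1$ lies in a row strictly below that of $i$. For a composition $\alpha$, $\mathcal{S}(\alpha)=\{\alpha_1,\alpha_1+\alpha_2,\dots,\alpha_1+\dots+\alpha_{\ell(\alpha)-1}\}$.
   Formalization: In the ''in particular'' part the condition used is p_i = ℓ(α)−i for all i (connected ribbon); ℓ(p)=ℓ(α)−1 alone is not equivalent to it: for α=(2,2,2), p=(1,1,0), ν=(5,1) the conditions hold but no standard tableau has descent set {2,4}. *)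

(* Defs.v *)
From Stdlib Require Import ClassicalEpsilon.
From mathcomp Require Import all_boot all_order all_algebra.
From mathcomp Require Import mpoly.

Set Implicit Arguments.
Unset Strict Implicit.
Unset Printing Implicit Defensive.

Import GRing.Theory.
Local Open Scope ring_scope.

(* Partitions are sequences of natural numbers.  Rows, columns and parts are
   numbered from 0, and [nth 0 s i] gives part i, with value 0 beyond the
   length of s. *)
Definition is_partition (s : seq nat) : bool :=
  sorted geq s && (0%N \notin s).

Definition nonzero_parts (s : seq nat) : nat := count (leq 1) s.

Definition dominated (s t : seq nat) : Prop :=
  sumn s = sumn t /\ forall k : nat, (sumn (take k s) <= sumn (take k t))%N.

(* The box in row i (numbered downwards) and column j belongs to lam/mu. *)
Definition in_skew (lam mu : seq nat) (i j : nat) : bool :=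
  (nth 0 mu i <= j < nth 0 lam i)%N.

Definition is_skew_shape (lam mu : seq nat) : Prop :=
  [/\ is_partition lam, is_partition mu
    & forall i : nat, (nth 0 mu i <= nth 0 lam i)%N].

Definition box (lam mu : seq nat) : finType :=
  {b : 'I_(size lam) * 'I_(nth 0%N lam 0) | in_skew lam mu b.1 b.2}.

Definition brow (lam mu : seq nat) (b : box lam mu) : nat := (val b).1.
Definition bcol (lam mu : seq nat) (b : box lam mu) : nat := (val b).2.

Definition semistandard (n : nat) (lam mu : seq nat)
    (T : {ffun box lam mu -> 'I_n}) : bool :=
  [forall b, forall b',
     ((brow b == brow b') && (bcol b < bcol b') ==> (T b <= T b'))%N &&
     ((bcol b == bcol b') && (brow b < brow b') ==> (T b < T b'))%N].

Definition skew_schur (n : nat) (lam mu : seq nat) : {mpoly int[n]} :=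
  \sum_(T : {ffun box lam mu -> 'I_n} | semistandard T) \prod_b 'X_(T b).

Definition schur (n : nat) (nu : seq nat) : {mpoly int[n]} :=
  skew_schur n nu [::].

(* The identity s_(lam/mu) = sum_nu c(nu) s_nu of symmetric functions: it holds
   in every finite number n of variables, with the same coefficients.  A
   partition of N has at most N parts, all at most N, so the sum ranges over
   all partitions nu of N = |lam/mu|. *)
Definition schur_expansion (lam mu : seq nat) (c : seq nat -> int) : Prop :=
  let N := (sumn lam - sumn mu)%N in
  forall n : nat,
    skew_schur n lam mu =
      \sum_(t : N.-bseq 'I_N.+1 | is_partition (map val t) &&
                                  (sumn (map val t) == N))
         c (map val t) *: schur n (map val t).

(* Schur functions form a basis of the symmetric functions, so the predicate
   [schur_expansion lam mu] determines c on the partitions of |lam/mu|. *)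
Definition lr_coef (lam mu : seq nat) : seq nat -> int :=
  epsilon (inhabits (fun=> 0)) (schur_expansion lam mu).

Definition shared_columns (lam mu : seq nat) (i j : nat) : nat :=
  count (fun c => in_skew lam mu i c && in_skew lam mu j c)
        (iota 0 (nth 0%N lam 0)).

Definition no_square (lam mu : seq nat) : Prop :=
  forall i j : nat,
    ~~ [&& in_skew lam mu i j, in_skew lam mu i j.+1,
           in_skew lam mu i.+1 j & in_skew lam mu i.+1 j.+1].

(* Components of a disconnected ribbon may be placed at any distance from each
   other, as long as no row of the skew diagram is empty. *)
Definition is_ribbon (alpha lam mu : seq nat) : Prop :=
  [/\ is_skew_shape lam mu,
      no_square lam mu,
      size lam = size alpha /\
        (forall i : nat, nth 0 lam i - nth 0 mu i = nth 0 alpha i)%N,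
      forall i : nat, (shared_columns lam mu i i.+1 <= 1)%N
    & forall i j : nat, (i.+1 < j)%N -> shared_columns lam mu i j = 0%N].

Definition column_length (lam mu : seq nat) (c : nat) : nat :=
  count (fun r => in_skew lam mu r c) (iota 0 (size lam)).

(* Entry i counts the columns of length two with no box in rows 0 .. i-1. *)
Definition overlapping_partition (lam mu : seq nat) : seq nat :=
  [seq count (fun c => (column_length lam mu c == 2%N) &&
                       all (fun r => ~~ in_skew lam mu r c) (iota 0 i))
             (iota 0 (nth 0%N lam 0))
     | i <- iota 0 (size lam)].

(* The box b of a standard tableau U is labelled (U b).+1, so that the labels
   are 1, ..., |nu|. *)
Definition standard (nu : seq nat)
    (U : {ffun box nu [::] -> 'I_(sumn nu)}) : bool :=
  injectiveb U &&
  [forall b, forall b',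
     ((brow b == brow b') && (bcol b < bcol b') ==> (U b < U b'))%N &&
     ((bcol b == bcol b') && (brow b < brow b') ==> (U b < U b'))%N].

Definition descent_set (nu : seq nat)
    (U : {ffun box nu [::] -> 'I_(sumn nu)}) : pred nat :=
  fun i => [exists b, exists b',
    [&& (U b).+1 == i, (U b').+1 == i.+1 & (brow b < brow b')%N]].

Definition partial_sums (alpha : seq nat) : seq nat :=
  [seq sumn (take k alpha) | k <- iota 1 (size alpha).-1].

Definition ribbon_conditions (alpha p nu : seq nat) : Prop :=
  [/\ dominated alpha nu,
      dominated nu [:: (sumn alpha - nth 0 p 0)%N; nth 0%N p 0]
    & forall i : nat, (i < nonzero_parts p)%N ->
        (nth 0 nu i <= sumn (drop i alpha) - nth 0 p i)%N].

(* Main.v *)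
From Stdlib Require Import ClassicalEpsilon.
Require Import Defs.
From mathcomp Require Import all_boot all_order all_algebra.
From mathcomp Require Import mpoly.
From mathcomp Require Import zify.

Set Implicit Arguments.
Unset Strict Implicit.
Unset Printing Implicit Defensive.

Import GRing.Theory.

(** Splitting a ribbon at a shared column writes its Schur function as a product of complete
    functions minus the ribbon with the two rows merged.  With the Pieri rule, the coefficient of
    [s_nu] becomes the number of chains of horizontal strips of sizes [alpha_1, ..., alpha_l]
    filling [nu], such that for every overlap the lowest box of the next strip lies strictly below
    the highest box of the current one; for a connected ribbon these chains are the standard tableaux
    with descent set [S(alpha)].  The Pieri rule is proved by induction on the number of variables
    from the local rule [mu_i <-> lambda_(i+1)], and Schur polynomials are linearly independent
    since the content matrix is triangular for the weight [sum of i * nu_i].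

    Every chain satisfies the row bounds: an overlap forces a box outside row [i] among the values
    [>= i].  Conversely a chain is built from the last strip downwards: at most one row above the
    last row [q] exceeds the bound for the shorter ribbon; its excess is removed, then what the
    last row needs, and the remaining boxes are taken as low as possible.  To secure the next
    descent the strip must also contain a box of row [q], and the previous strip a box above it. *)

(** * Partitions and horizontal strips *)

(** All conditions are handled as bounds on tails. Since the sizes agree, [nu] dominates [alpha]
    exactly when the rows of [nu] from [k] on never hold more boxes than the corresponding rows of
    [alpha]; the row bounds refer to the same tails, and the upper end of the interval is the bound
    for the first row. Removing the lowest ribbon row, of length [a], lowers every tail that
    contains it by exactly [a], which is why ribbons are taken apart from the bottom. A strip taken
    as low as possible respects dominance, but it may leave a row too long for the shorter ribbon.
    Two such rows above the last one cannot coexist: parts at least 2 in weakly decreasing order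
    make each of them use up more boxes than the other leaves below it. [lr_coef] is a chosen
    solution of the expansion identity, so two facts identify it: chain counts solve the identity
    for every number of variables, and the solution is unique, which is read off in [sumn alpha]
    variables. The bound [N] on sizes only keeps sums over partitions finite; it reappears as the
    size hypothesis of the Pieri rule. *)

Local Notation pt := (nth 0) (only parsing).
Local Notation tl s k := (sumn (drop k s)) (only parsing).

Lemma tailE (s : seq nat) k : tl s k = pt s k + tl s k.+1.
Proof.
have [lt_ks|le_sk] := ltnP k (size s); first by rewrite (drop_nth 0).
by rewrite !drop_oversize ?nth_default //; lia.
Qed.

Lemma part_step s i : is_partition s -> pt s i.+1 <= pt s i.
Proof.
case/andP=> ss _; have [lt_is|le_si] := ltnP i.+1 (size s); last by rewrite nth_default.
by apply: (@sorted_ltn_nth _ geq _ 0 s ss) => //; rewrite ?inE; try lia; move=> a b c /=; lia.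
Qed.

Lemma part_mono s i j : is_partition s -> i <= j -> pt s j <= pt s i.
Proof.
move=> ps; elim: j => [|j IH]; first by rewrite leqn0 => /eqP->.
rewrite leq_eqVlt => /predU1P[->//|]; rewrite ltnS => /IH.
by apply: leq_trans; apply: part_step.
Qed.

Lemma pt_gt0 s i : is_partition s -> (0 < pt s i) = (i < size s).
Proof.
case/andP=> _ s0; have [lt_is|le_si] := ltnP i (size s); last by rewrite nth_default.
by rewrite lt0n; apply: contra s0 => /eqP <-; apply: mem_nth.
Qed.

Lemma part_ext s t : is_partition s -> is_partition t -> (forall i, pt s i = pt t i) -> s = t.
Proof.
move=> ps pt_ e; have es i : (i < size s) = (i < size t).
  by rewrite -!pt_gt0 // e.
apply: (@eq_from_nth _ 0) => [|i _]; last exact: e.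
by move: (es (size s)) (es (size t)); rewrite !ltnn; lia.
Qed.

(** For a weakly decreasing [f] vanishing from [M] on, the discarded zeros are all trailing, so the
    filter keeps every index in place. *)
Definition part_of (f : nat -> nat) M := [seq x <- mkseq f M | 0 < x].

Lemma nth_filter_gt0 f k M i : (forall i, f i.+1 <= f i) ->
  (forall i, k + M <= i -> f i = 0) ->
  pt [seq x <- map f (iota k M) | 0 < x] i = f (k + i).
Proof.
move=> fd; elim: M k i => [|M IH] k i f0 /=.
  by rewrite nth_nil f0 //; lia.
have {}IH j : pt [seq x <- map f (iota k.+1 M) | 0 < x] j = f (k.+1 + j).
  by apply: IH => l hl; apply: f0; lia.
case: ltnP => [fk|fk]; first by case: i => [|i] /=; rewrite ?addn0 // IH addSnnS.
have z j : f (k + j) = 0.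
  by elim: j => [|j IHj]; [rewrite addn0; lia| rewrite addnS; move: (fd (k + j)); lia].
by rewrite IH addSnnS !z.
Qed.

Lemma nth_part_of f M i : (forall i, f i.+1 <= f i) -> (forall i, M <= i -> f i = 0) ->
  pt (part_of f M) i = f i.
Proof. by move=> fd f0; rewrite nth_filter_gt0. Qed.

Lemma part_of_part f M : (forall i, f i.+1 <= f i) -> is_partition (part_of f M).
Proof.
move=> fd; apply/andP; split; last by rewrite mem_filter.
apply: sorted_filter; first by move=> a b c /=; lia.
apply/(sortedP 0) => i; rewrite size_mkseq => lt_iM.
by rewrite !nth_mkseq //=; lia.
Qed.

Lemma sumn_nth s M : size s <= M -> sumn s = \sum_(i < M) pt s i.
Proof.
elim: s M => [|x s IH] M /=; first by move=> _; rewrite big1 // => i _; rewrite nth_nil.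
by case: M => // M sM; rewrite big_ord_recl /= (IH M).
Qed.

(** Tail sums are determined by their recurrence. Partitions can thus be built by prescribing tails
    and taking differences as rows. *)
Lemma tail_unique s F M : size s <= M -> F M = 0 ->
  (forall k, F k = pt s k + F k.+1) -> forall k, k <= M -> tl s k = F k.
Proof.
move=> sM FM FE k; move: {2}(M - k) (erefl (M - k)) => d.
elim: d k => [|d IH] k dE le_kM.
  have -> : k = M by lia.
  by rewrite drop_oversize.
by rewrite tailE FE IH //; lia.
Qed.

Lemma part_size_sumn s : is_partition s -> size s <= sumn s.
Proof.
case/andP=> _; elim: s => //= x s IH; rewrite inE negb_or => /andP[x0 /IH]; lia.
Qed.

Lemma pt_sumn s i : pt s i <= sumn s.
Proof.
elim: s i => [|x s IH] [|i] //=; first lia.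
by move: (IH i); lia.
Qed.

Lemma part_sumn0 s : is_partition s -> sumn s = 0 -> s = [::].
Proof. by move=> ps s0; apply: size0nil; move: (part_size_sumn ps); lia. Qed.

(** Interlacing form of a horizontal strip: no column of [l/m] has two boxes when each row of [m]
    reaches at least as far as the next row of [l]. *)
Definition hstrip (l m : seq nat) : bool :=
  all (fun i => pt l i.+1 <= pt m i <= pt l i) (iota 0 (maxn (size l) (size m))).

Lemma hstripP l m : reflect (forall i, pt l i.+1 <= pt m i <= pt l i) (hstrip l m).
Proof.
apply: (iffP allP) => [h i|h i _]; last exact: h.
case: (ltnP i (maxn (size l) (size m))) => hi; first by apply: h; rewrite mem_iota.
by rewrite !nth_default //; lia.
Qed.

Lemma hstrip_sub l m : hstrip l m -> forall i, pt m i <= pt l i.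
Proof. by move/hstripP=> h i; case/andP: (h i). Qed.

Lemma sum_le_sub l m : (forall i, pt m i <= pt l i) -> sumn m <= sumn l.
Proof.
move=> h; rewrite (@sumn_nth m (maxn (size l) (size m))) ?leq_maxr //.
by rewrite (@sumn_nth l (maxn (size l) (size m))) ?leq_maxl // leq_sum.
Qed.

Lemma hstrip_sumn l m : hstrip l m -> sumn m <= sumn l.
Proof. by move/hstrip_sub/sum_le_sub. Qed.

(** The enumeration goes through the index type of [schur_expansion], so that the sum there becomes
    a sum over a plain list. *)
Definition partitions_le N : seq (seq nat) :=
  [seq s <- [seq map val (bseqval t) | t <- enum {: N.-bseq 'I_N.+1}] | is_partition s && (sumn s <= N)].

Lemma mem_partitions_le N s : (s \in partitions_le N) = is_partition s && (sumn s <= N).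
Proof.
rewrite mem_filter; case: (boolP (is_partition s && (sumn s <= N))) => //= /andP[ps sN].
have hN : all (fun x => x < N.+1) s.
  by apply/(all_nthP 0) => i _; rewrite ltnS (leq_trans _ sN) ?pt_sumn.
have hsz : size (pmap insub s : seq 'I_N.+1) <= N.
  rewrite size_pmap_sub; apply: leq_trans (count_size _ _) _.
  by apply: leq_trans sN; apply: part_size_sumn.
apply/mapP; exists (Bseq hsz); first by rewrite mem_enum.
rewrite /=; elim: s {ps sN hsz} hN => //= x s IH /andP[hx /IH {1}->].
by case: insubP => [u _ /= -> //|]; rewrite hx.
Qed.

Lemma partitions_le_uniq N : uniq (partitions_le N).
Proof.
apply: filter_uniq; rewrite map_inj_uniq ?enum_uniq // => t u /inj_map e.
by apply/val_inj/e; apply: val_inj.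
Qed.

Lemma partitions_le_part N s : s \in partitions_le N -> is_partition s.
Proof. by rewrite mem_partitions_le => /andP[]. Qed.

Lemma sum_partitions_le (V : nmodType) N (F : seq nat -> V) :
  (\sum_(t : N.-bseq 'I_N.+1 | is_partition (map val t) && (sumn (map val t) == N)) F (map val t)
  = \sum_(s <- partitions_le N | sumn s == N) F s)%R.
Proof.
rewrite /partitions_le big_filter_cond big_map big_enum_cond; apply: eq_bigl => t /=.
by rewrite -andbA; congr (_ && _); lia.
Qed.

(** * Chains of horizontal strips with prescribed descents *)

(* A ribbon is encoded by its rows from bottom to top, each with a flag telling whether it shares
   a column with the row above it.  Row indices still count from the top, so in
   [(a, e) :: L] the head is row [size L], and [rows_tail L i], [overlaps_tail L i] count
   the boxes and the overlaps in rows [i] and below. *)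
Fixpoint rows_tail (L : seq (nat * bool)) (i : nat) : nat :=
  if L is (a, e) :: L' then (if i <= size L' then a + rows_tail L' i else 0) else 0.

Fixpoint overlaps_tail (L : seq (nat * bool)) (i : nat) : nat :=
  if L is (a, e) :: L' then (if i < size L' then e + overlaps_tail L' i else 0) else 0.

Definition strip_descent (l m r : seq nat) : bool :=
  has (fun j => (pt m j < pt l j) && has (fun i => pt r i < pt m i) (iota 0 j)) (iota 0 (size l)).

Lemma strip_descentP l m r :
  reflect (exists i j, [/\ i < j, pt r i < pt m i & pt m j < pt l j]) (strip_descent l m r).
Proof.
apply: (iffP hasP) => [[j _ /andP[h1 /hasP[i]]]|[i [j [ij h1 h2]]]].
  by rewrite mem_iota add0n => /andP[_ ij] h2; exists i, j.
exists j; last by rewrite h2; apply/hasP; exists i => //; rewrite mem_iota.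
rewrite mem_iota /= add0n; case: ltnP => // h; by rewrite (nth_default _ h) in h2.
Qed.

(* [l/m] is the last strip of the chain. *)
Fixpoint ribbon_chain (L : seq (nat * bool)) (l m : seq nat) : Prop :=
  if L is (a, e) :: L' then
    [/\ is_partition m, hstrip l m, sumn l = sumn m + a
      & exists2 r, ribbon_chain L' m r & e -> strip_descent l m r]
  else l = [::] /\ m = [::].

(** * Existence of chains under the numerical conditions *)

Lemma greedy_strip n (e : nat -> nat) E a (D : nat -> nat) :
  is_partition n ->
  (forall j, e j + pt n j.+1 <= pt n j) ->
  (forall j, E j.+1 = E j + e j) -> E 0 = 0 ->
  (forall k, tl n k + E k <= a + D k) ->
  (forall k, tl n k.+1 <= D k) ->
  (forall k, E k <= a) -> a <= pt n 0 ->
  exists2 m, is_partition m & [/\ hstrip n m, sumn n = sumn m + a,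
    forall j, pt m j + e j <= pt n j & forall k, tl m k <= D k].
Proof.
move=> pn en ES E0 hD1 hD2 hEa an.
(* [e j] boxes are reserved in row [j], hence [E k] of them above row [k]. From row [k] down a strip
   can therefore remove at most [a - E k] boxes, and at most [pt n k] because the gaps between rows
   telescope. [F] is the smallest tail allowed by both limits, and the rows of [m] are its
   differences. *)
pose F k := maxn (tl n k + E k - a) (tl n k.+1).
have FE k : pt n k.+1 + F k.+1 <= F k <= pt n k - e k + F k.+1.
  move: (tailE n k) (tailE n k.+1) (ES k) (en k) (hEa k.+1); rewrite /F; lia.
pose f k := F k - F k.+1.
have fb k : pt n k.+1 <= f k <= pt n k - e k by move: (FE k); rewrite /f; lia.
have fd k : f k.+1 <= f k by move: (fb k) (fb k.+1); lia.
have F0 k : size n <= k -> F k = 0.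
  move=> h; rewrite /F !drop_oversize //=; last lia.
  by move: (hEa k); lia.
have f0 k : size n <= k -> f k = 0 by move=> h; rewrite /f !F0 //; lia.
pose m := part_of f (size n).
have mE k : pt m k = f k by apply: nth_part_of.
have pm : is_partition m by apply: part_of_part.
have sm : size m <= size n.
  by have := pt_gt0 (size n) pm; rewrite mE f0 // ltnn; case: ltnP.
have tm k : tl m k = F k.
  have [le_kn|lt_nk] := leqP k (size n).
    apply: (@tail_unique m F (size n)) => //; first by rewrite F0.
    by move=> j; rewrite mE; move: (FE j); rewrite /f; lia.
  by rewrite F0 ?drop_oversize //; lia.
exists m => //; split.
- by apply/hstripP=> i; rewrite mE; move: (fb i); lia.
- rewrite -(drop0 m) tm /F E0 drop0.
  move: (tailE n 0); rewrite drop0; lia.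
- by move=> j; rewrite mE; move: (fb j) (en j); lia.
- by move=> k; rewrite tm /F; move: (hD1 k) (hD2 k); lia.
Qed.

Fixpoint ordered_rows (L : seq (nat * bool)) : bool :=
  if L is (a, e) :: L' then
    [&& 1 < a, (if L' is (b, _) :: _ then a <= b else ~~ e) & ordered_rows L']
  else true.

Lemma rows_tail_size L i : size L <= i -> rows_tail L i = 0.
Proof. by case: L => //= -[a e] L h; case: leqP => //; lia. Qed.

Lemma overlaps_tail_size L i : size L <= i.+1 -> overlaps_tail L i = 0.
Proof. by case: L => //= -[a e] L h; case: ltnP => //; lia. Qed.

Lemma overlaps_tail_le L i : overlaps_tail L i <= (size L).-1 - i.
Proof.
elim: L => //= -[a e] L IH; case: ltnP => //= h; case: e; move: IH; rewrite -/size; lia.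
Qed.

Lemma rows_tail_ge L a i : ordered_rows L -> (if L is (b, _) :: _ then a <= b else true) -> a * (size L - i) <= rows_tail L i.
Proof.
elim: L => [|[b e] L IH] /=; first by move=> _ _; rewrite sub0n muln0.
case/and3P=> _ bL wL ab; case: (leqP i (size L)) => h; last by move: (h); rewrite -subn_eq0 => /eqP->; rewrite muln0.
rewrite subSn // mulnS leq_add //; apply: IH => //.
by case: (L) bL => // -[c e'] l; lia.
Qed.

Lemma rows_tail_ge2 L i : ordered_rows L -> 2 * (size L - i) <= rows_tail L i.
Proof. by move=> wL; apply: rows_tail_ge => //; case: L wL => //= -[b e] L /and3P[]. Qed.

(** Each row from [i.+1] on is compared with the row above it, which is at least as long. This gives
    the first row of a shape room for [a] boxes and yields one of the two caps that [greedy_strip]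
    asks for. *)
Lemma rows_tail_shift a e L i : ordered_rows ((a, e) :: L) -> rows_tail ((a, e) :: L) i.+1 <= rows_tail L i.
Proof.
elim: L a e i => [|[b e'] L IH] a e i /=; first by [].
case/and3P=> _ ab wL; rewrite !ltnS; have := IH b e' i wL; rewrite /=.
by case: (leqP i (size L)) => h; case: (ltnP i (size L)) => h'; lia.
Qed.

Lemma overlaps_rows_tail L i : ordered_rows L -> overlaps_tail L i <= rows_tail L i.
Proof. by move/(@rows_tail_ge2 _ i); move: (overlaps_tail_le L i); lia. Qed.

Lemma tail_ge n q i k : is_partition n -> q < size n -> i <= k -> k <= q ->
  (k - i) * pt n q + tl n k <= tl n i.
Proof.
move=> pn hq; elim: k => [|k IH] ik kq; first by rewrite (_ : i = 0) //; lia.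
have [->|ik'] := eqVneq i k.+1; first by rewrite subnn.
have ik2 : i <= k by lia.
by move: (IH ik2 (ltnW kq)) (part_mono pn (ltnW kq)); rewrite (tailE n k) (subSn ik2) mulSn; lia.
Qed.

(* [x] boxes leave row [i], the only row above the last row [q] exceeding the bound of the shorter
   ribbon, and [y] boxes leave row [q]. *)
Lemma strip_choice a (e : bool) L n q (f : bool) (y := maxn e (pt n q + overlaps_tail ((a, e) :: L) q - rows_tail L q)) :
  ordered_rows ((a, e) :: L) -> is_partition n -> size n = q.+1 -> q <= size L ->
  (forall k, tl n k <= rows_tail ((a, e) :: L) k) ->
  (forall k, pt n k + overlaps_tail ((a, e) :: L) k <= rows_tail ((a, e) :: L) k) ->
  (f -> [/\ 0 < q, pt n q < pt n q.-1 & pt n q + overlaps_tail ((a, e) :: L) q < rows_tail ((a, e) :: L) q]) ->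
  exists i x, [/\ 0 < x -> i < q /\ x + pt n i.+1 <= pt n i, x + y <= a,
    forall k, i < k <= q -> x + tl n k <= a + rows_tail L k,
    forall j, j < q -> pt n j - (if j == i then x else 0) + overlaps_tail L j <= rows_tail L j
    & f -> 0 < x].
Proof.
move=> wL pn sn qL htl hrow hf.
have [a2 wL'] : 1 < a /\ ordered_rows L by case/and3P: wL.
have HA2 k := @rows_tail_ge2 L k wL'.
have HAa k : a * (size L - k) <= rows_tail L k.
  by apply: rows_tail_ge => //; case: (L) wL => // -[b e'] L' /and3P[_ ->].
have HP k := overlaps_tail_le L k.
have AE k : k <= size L -> rows_tail ((a, e) :: L) k = a + rows_tail L k by rewrite /= => ->.
have PE k : k < size L -> overlaps_tail ((a, e) :: L) k = e + overlaps_tail L k by rewrite /= => ->.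
have Pq : overlaps_tail ((a, e) :: L) q <= size L - q by have := overlaps_tail_le ((a, e) :: L) q.
have nq : 0 < pt n q by rewrite pt_gt0 // sn.
have e1 : e <= 1 by case: e {wL htl hrow hf AE PE Pq y}.
have tq k : q < k -> tl n k = 0 by move=> h; rewrite drop_oversize ?sn.
have tqq : tl n q = pt n q by rewrite tailE tq ?addn0.
have [[i hi] | no] : {i | (i < q) && (rows_tail L i < pt n i + overlaps_tail L i)} +
                     {forall i, i < q -> pt n i + overlaps_tail L i <= rows_tail L i}.
  case: (boolP (has (fun i => rows_tail L i < pt n i + overlaps_tail L i) (iota 0 q))) => [h|h].
    left; exists (nth 0 (iota 0 q) (find (fun i => rows_tail L i < pt n i + overlaps_tail L i) (iota 0 q))).
    rewrite (nth_find 0 h) andbT; have := h; rewrite has_find size_iota => h'.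
    by rewrite nth_iota.
  right=> i hi; move/hasPn: h => /(_ i); rewrite mem_iota /= -leqNgt; exact.
- move/andP: hi => [iq hi].
  exists i, (pt n i + overlaps_tail L i - rows_tail L i).
  set x := pt n i + overlaps_tail L i - rows_tail L i.
  have xE : x + rows_tail L i = pt n i + overlaps_tail L i by rewrite /x; lia.
  have ht : pt n i + tl n i.+1 <= a + rows_tail L i by rewrite -tailE -AE ?htl //; lia.
  have xt : x + tl n i.+1 <= a + overlaps_tail L i by lia.
  have Pi : overlaps_tail L i + i.+1 <= size L by move: (HP i); lia.
  have gt k : i < k <= q -> (k - i.+1) + tl n k <= tl n i.+1.
    move=> /andP[ik kq]; have := @tail_ge n q i.+1 k pn _ ik kq.
    rewrite sn ltnSn => /(_ isT); apply: leq_trans; rewrite leq_add2r.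
    by rewrite leq_pmulr.
  have xe : x + e <= a by move: (hrow i); rewrite AE ?PE; lia.
  split.
  (* With [size L - i = u.+1], row [i] keeps [rows_tail L i - overlaps_tail L i], at least [a + u],
     boxes after losing its excess, while all rows below it hold at most [a + u] together; so the
     strip stays horizontal. *)
  + split=> //; have := HAa i; have := tailE n i.+1.
    have [u uE] : exists u, size L - i = u.+1 by exists (size L - i).-1; lia.
    rewrite uE mulnS => h1 h2.
    have h3 : 2 * u <= a * u by rewrite leq_mul2r a2 orbT.
    by lia.
  + rewrite /y; have := gt q; rewrite tqq iq leqnn => /(_ isT).
    by move: (HA2 q); lia.
  + by move=> k ik; move: (gt k ik) (HA2 k); lia.
  + move=> j jq; case: eqP => [->|/eqP ji]; first by move: (overlaps_rows_tail i wL'); lia.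
    rewrite subn0 leqNgt; apply/negP => hj.
    (* An excess in row [i0] leaves fewer than [a + overlaps_tail L i0] boxes below it. An excess in
       row [j0] takes more than [a + u] of them, where [size L - j0 = u.+1], and every other row
       down to [q] takes at least one: too many in total. *)
    have contra i0 j0 : i0 < j0 -> j0 < q -> rows_tail L i0 < pt n i0 + overlaps_tail L i0 ->
       rows_tail L j0 < pt n j0 + overlaps_tail L j0 -> False.
      move=> ij jq0 h1 h2.
      have := @tail_ge n q i0.+1 j0 pn _ ij (ltnW jq0); rewrite sn ltnSn => /(_ isT) h3.
      have h4 : j0 - i0.+1 <= (j0 - i0.+1) * pt n q by rewrite leq_pmulr.
      have := @tail_ge n q j0.+1 q pn _ jq0 (leqnn q); rewrite sn ltnSn => /(_ isT) h5.
      have := htl i0; rewrite AE; last lia.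
      have [u uE] : exists u, size L - j0 = u.+1 by exists (size L - j0).-1; lia.
      have := HAa j0; rewrite uE mulnS => h6.
      have h7 : 2 * u <= a * u by rewrite leq_mul2r a2 orbT.
      move: (tailE n i0) (tailE n j0) (HP i0) (HP j0); lia.
    by case: (ltngtP i j) ji => // h _; [apply: (contra i j) | apply: (contra j i)].
  + by move=> _; rewrite /x; lia.
- case: f hf => [/(_ isT)[q0 h1 h2]|_].
  (* No row has an excess, but [f] still demands a box above row [q]. One box of row [q.-1] serves;
     [h1] makes it removable and [h2] leaves room for it in the size [a]. *)
  + exists q.-1, 1; have h3 := AE q qL.
    split=> //.
    * by move=> _; rewrite prednK //; lia.
    * rewrite /y; lia.
    * move=> k hk; have -> : k = q by lia.
      rewrite tqq; lia.
    * by move=> j jq; move: (no j jq); case: ifP; lia.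
  + exists 0, 0; split=> //.
    * by rewrite /y; move: (hrow q); rewrite AE //; lia.
    * by move=> k /andP[_ kq]; rewrite add0n -AE ?htl //; lia.
    * by move=> j jq; rewrite if_same subn0 no.
Qed.

Lemma ribbon_chain_nonempty L l m : ordered_rows L -> ribbon_chain L l m -> l != [::] -> exists j, pt m j < pt l j.
Proof.
case: L => [_ [-> _]//|[a e] L /and3P[a1 _ _] [_ hlm sE _] _].
have [h|h] := boolP (has (fun j => pt m j < pt l j) (iota 0 (size l))).
  by case/hasP: h => j _ hj; exists j.
have : sumn l <= sumn m; last lia.
apply: sum_le_sub => i; case: (ltnP i (size l)) => hi; last by rewrite nth_default.
by move/hasPn: h => /(_ i); rewrite mem_iota -leqNgt; apply.
Qed.

(* The flag [f] asks in addition for a box of the last strip above the last row; the induction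
   needs it to create a descent towards a strip that meets the last row without exhausting it. *)
Theorem chain_exists L n (f : bool) : ordered_rows L -> is_partition n -> sumn n = rows_tail L 0 ->
  (forall k, tl n k <= rows_tail L k) -> (forall k, pt n k + overlaps_tail L k <= rows_tail L k) ->
  (f -> let q := (size n).-1 in
     [/\ 0 < q, pt n q < pt n q.-1 & pt n q + overlaps_tail L q < rows_tail L q]) ->
  exists2 r, ribbon_chain L n r & f -> exists2 j, j < (size n).-1 & pt r j < pt n j.
Proof.
elim: L n f => [|[a e] L IH] n f wL pn sn htl hrow hf.
  have n0 : n = [::] by apply: part_sumn0.
  by exists [::] => [|/hf]; rewrite n0 //= => -[].
have [a2 wL'] : 1 < a /\ ordered_rows L by case/and3P: wL.
have AL0 : rows_tail ((a, e) :: L) 0 = a + rows_tail L 0 by [].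
have [q szq] : exists q, size n = q.+1.
  by exists (size n).-1; move: sn; rewrite AL0; case: (n) => //=; lia.
have nq : 0 < pt n q by rewrite pt_gt0 // szq.
have qL : q <= size L.
  rewrite leqNgt; apply/negP => h; move: (hrow q).
  by rewrite (@rows_tail_size ((a, e) :: L)) //=; lia.
rewrite szq /= in hf *.
have [i [x [hx hxy hdom hcap fx]]] := strip_choice wL pn szq qL htl hrow hf.
set y := maxn _ _ in hxy.
have Pq : overlaps_tail ((a, e) :: L) q <= rows_tail L q.
  by have := overlaps_tail_le ((a, e) :: L) q; have := @rows_tail_ge2 L q wL'; rewrite /=; lia.
have e1 : e <= 1 by case: (e).
have yq : y <= pt n q by rewrite /y; lia.
(* The overlaps here are those of the longer ribbon. When [e] holds and [q < size L] they exceed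
   those of [L] by one, so row [q] ends strictly below its new bound, as the flag of the inductive
   call requires. *)
have yb : pt n q + overlaps_tail ((a, e) :: L) q <= rows_tail L q + y by rewrite /y; lia.
have ye : e <= y by rewrite /y leq_maxl.
clearbody y.
have pnq1 : pt n q.+1 = 0 by rewrite nth_default ?szq.
have AE k : k <= size L -> rows_tail ((a, e) :: L) k = a + rows_tail L k by rewrite /= => ->.
have an : a <= pt n 0.
  have := tailE n 0; rewrite drop0 sn AL0; have := htl 1; have := rows_tail_shift 0 wL; lia.
pose ee j := (if j == i then x else 0) + (if j == q then y else 0).
pose E k := (if i < k then x else 0) + (if q < k then y else 0).
have [|||k|k|k||n' pn' [hstrip' sn' hrem tn']] := @greedy_strip n ee E a (rows_tail L) pn.
- move=> j; rewrite /ee; case: (posnP x) => [x0|/hx[iq hxi]].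
    by rewrite x0 if_same; case: eqP => [->|_]; [lia | rewrite part_step].
  case: eqP => [->|_]; first by rewrite (ltn_eqF iq); lia.
  by case: eqP => [->|_]; [lia | rewrite part_step].
- by move=> j; rewrite /E /ee !ltnS; case: (ltngtP i j); case: (ltngtP q j); lia.
- by rewrite /E.
- rewrite /E; case: (ltnP q k) => qk.
    rewrite drop_oversize ?szq //=; case: ifP; lia.
  case: ifP => ik; first by move: (hdom k); rewrite ik qk => /(_ isT); lia.
  by rewrite !addn0 -AE ?htl //; lia.
- by apply: leq_trans (rows_tail_shift k wL).
- by rewrite /E; case: ifP; case: ifP; lia.
- exact: an.
have hrow' k : pt n' k + overlaps_tail L k <= rows_tail L k.
  move: (hrem k); rewrite /ee; case: (ltngtP k q) => [kq|qk|->].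
  - by rewrite addn0; move: (hcap k kq); lia.
  - rewrite (nth_default 0 (_ : size n <= k)) ?szq //; move: (overlaps_rows_tail k wL'); lia.
  - suff : overlaps_tail L q <= overlaps_tail ((a, e) :: L) q by lia.
    rewrite /=; case: ltnP => h; first lia.
    by rewrite overlaps_tail_size //; lia.
have sn'A : sumn n' = rows_tail L 0 by lia.
(* The strip being removed has a box in row [q] when [e] holds. If row [q] survives, the previous
   strip must be asked for a box above it; if row [q] is exhausted, every box of the previous strip
   is above it anyway. *)
pose f' := e && (0 < pt n' q).
have hn'q : pt n' q + y <= pt n q.
  by move: (hrem q); rewrite /ee eqxx; lia.
have sz' : size n' <= q.+1.
  by have := pt_gt0 q.+1 pn'; move: (hrem q.+1); lia.
have [|r Cr fr] := IH n' f' wL' pn' sn'A tn' hrow'.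
  case/andP=> et n'q /=; rewrite et in ye hrow htl yb.
  have -> : size n' = q.+1.
    by apply/eqP; rewrite eqn_leq sz' -pt_gt0.
  have qltL : q < size L.
    rewrite ltnNge; apply/negP => h; move: (hrow' q); rewrite rows_tail_size //; lia.
  rewrite /=; split.
  - rewrite lt0n; apply/eqP => q0; move: (hrow 0) sn; rewrite AL0.
    have : tl n 1 = 0 by rewrite drop_oversize // szq q0.
    have := tailE n 0; rewrite drop0 /=; case: (L) qltL => //= *; lia.
  - have q0 : 0 < q.
      rewrite lt0n; apply/eqP => q0; move: (hrow 0) sn; rewrite AL0.
      have : tl n 1 = 0 by rewrite drop_oversize // szq q0.
      have := tailE n 0; rewrite drop0 /=; case: (L) qltL => //= *; lia.
    by move/hstripP: hstrip' => /(_ q.-1); rewrite prednK //; lia.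
  - by move: yb; rewrite /= qltL; lia.
exists n'; last first.
  move=> /fx x0; have [iq _] := hx x0; exists i => //.
  by move: (hrem i); rewrite /ee eqxx; lia.
split=> //; exists r => // et; apply/strip_descentP.
case: (posnP (pt n' q)) => n'q; last first.
  rewrite et in ye; have := fr; rewrite /f' et n'q => /(_ isT)[j jq hj].
  by exists j, q; split=> //; lia.
have n'0 : n' != [::].
  apply/eqP => n'0; case: (L) wL sn'A => [|[b e'] L0]; first by rewrite et; case/and3P.
  by rewrite n'0 => /and3P[_ ab _] /=; lia.
have [j hj] := ribbon_chain_nonempty wL' Cr n'0.
exists j, q; split=> //; last by rewrite et in ye; lia.
rewrite ltnNge; apply/negP => qj; have := part_mono pn' qj; lia.
Qed.

(** * Necessity of the tail and row bounds *)

Lemma strip_rows l m js : (forall i, pt m i <= pt l i) -> uniq js ->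
  \sum_(j <- js) (pt l j - pt m j) + sumn m <= sumn l.
Proof.
move=> hml ujs; pose M := (size l + size m + sumn js).+1.
rewrite (@sumn_nth m M) ?(@sumn_nth l M); try by rewrite /M; lia.
have -> : \sum_(i < M) pt l i = \sum_(i < M) (pt l i - pt m i) + \sum_(i < M) pt m i.
  by rewrite -big_split; apply: eq_bigr => i _ /=; rewrite subnK.
rewrite leq_add2r -(big_mkord xpredT (fun i => pt l i - pt m i)).
rewrite /index_iota subn0 [X in _ <= X](bigID (mem js)) /= -[X in _ <= X + _]big_filter.
have -> : \sum_(j <- js) (pt l j - pt m j) =
          \sum_(j <- [seq i <- iota 0 M | i \in js]) (pt l j - pt m j).
  apply: perm_big; apply: uniq_perm; rewrite ?filter_uniq ?iota_uniq // => j.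
  rewrite mem_filter mem_iota /= add0n; case: (boolP (j \in js)) => //= hj; rewrite /M.
  suff : j <= sumn js by lia.
  by elim: (js) hj => //= x s IH; rewrite inE => /predU1P[->|/IH]; lia.
exact: leq_addr.
Qed.

(** A horizontal strip opens at most one new row and adds at most its own size to any tail. *)
Lemma ribbon_chain_tail L l m : ribbon_chain L l m -> is_partition l ->
  [/\ size l <= size L, sumn l = rows_tail L 0 & forall k, tl l k <= rows_tail L k].
Proof.
elim: L l m => [|[a e] L IH] l m /=; first by case=> -> _ _; split.
case=> pm hlm sE [r /IH {IH} /(_ pm)[szm sm tm] _] pl.
have szl : size l <= (size L).+1.
  have := pt_gt0 (size L).+1 pl; move/hstripP: hlm => /(_ (size L)).
  by rewrite (nth_default _ szm); lia.
split=> //; first by lia.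
move=> k; case: (leqP k (size L)) => hk; last by rewrite drop_oversize //; lia.
apply: leq_trans (_ : a + tl m k <= _); last by rewrite leq_add2l.
have h j : sumn (take j m) <= sumn (take j l).
  apply: sum_le_sub => i; case: (ltnP i j) => ij; first by rewrite !nth_take // hstrip_sub.
  by rewrite !nth_default // size_take_min; lia.
move: sE; rewrite -{1}(cat_take_drop k l) -{1}(cat_take_drop k m) !sumn_cat.
by move: (h k); lia.
Qed.

(* The extra unit is the inductive invariant: a strip reaching above row [r] costs one more
   entry outside that row, which pays for the next descent. *)
Lemma ribbon_chain_row L l m r : ordered_rows L -> is_partition l -> ribbon_chain L l m ->
  pt l r + overlaps_tail L r <= rows_tail L r /\
  (r < size L -> (exists2 j, j < r & pt m j < pt l j) -> pt l r + overlaps_tail L r < rows_tail L r).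
Proof.
elim: L l m => [|[a e] L IH] l m wL pl.
  by case=> -> ->; rewrite nth_nil; split.
move=> Cl; have [szl _ _] := ribbon_chain_tail Cl pl.
case: Cl => pm hlm sE [t Ct et].
have [a2 wL'] : 1 < a /\ ordered_rows L by case/and3P: wL.
have [h1 h2] := IH _ _ wL' pm Ct.
have [szm _ _] := ribbon_chain_tail Ct pm.
have sub := hstrip_sub hlm.
have R2 j k : j != k -> pt l j + pt l k <= pt m j + pt m k + a.
  move=> jk; have := @strip_rows l m [:: j; k] sub.
  rewrite /= inE jk !big_cons big_nil => /(_ isT); move: (sub j) (sub k); lia.
have R3 i j k : i < j -> j < k -> pt l i + pt l j + pt l k <= pt m i + pt m j + pt m k + a.
  move=> ij jk; have := @strip_rows l m [:: i; j; k] sub.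
  rewrite /= !inE !big_cons big_nil negb_or; move: (sub i) (sub j) (sub k).
  have -> : [&& (i != j) && (i != k), j != k & true] by lia.
  by move=> ? ? ? /(_ isT); lia.
have R1 j : pt l j <= pt m j + a.
  have := @strip_rows l m [:: j] sub isT.
  by rewrite !big_cons big_nil; move: (sub j); lia.
have e1 : e <= 1 by case: (e).
rewrite /=; case: (ltngtP r (size L)) => hr /=; last first.
- rewrite hr rows_tail_size // addn0; move: (R1 (size L)); rewrite (nth_default _ szm) addn0 => h.
  split=> // _ [j jr hj]; have := R2 j (size L); rewrite (nth_default _ szm); lia.
- rewrite nth_default; last by move: szl => /=; lia.
  by split=> //; lia.
case: (posnP e) => [->|e0].
  split=> [|_ [j jr hj]]; first by move: (R1 r); lia.
  by have := R2 j r; lia.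
have eE : e by case: (e) e0.
have [i [k [ik hi hk]]] := strip_descentP _ _ _ (et eE).
(* If the box in row [i] of the previous strip is above row [r], the strict inductive bound pays for
   the overlap. Otherwise [r < k], and the box of [l/m] in row [k] is lost to row [r]; a further box
   in row [j] above [r] is lost in addition, whence [R3]. *)
have [ir|ri] := ltnP i r.
  have h3 : pt m r + overlaps_tail L r < rows_tail L r by apply: h2 => //; exists i.
  split=> [|_ [j jr hj]]; first by move: (R1 r); lia.
  by have := R2 j r; lia.
split; first by have := R2 k r; lia.
by move=> _ [j jr hj]; have := R3 j r k; lia.
Qed.

(** * The Pieri rule *)

Section LocalRule.

Variables (N k : nat) (nu ka : seq nat).
Hypotheses (pnu : is_partition nu) (pka : is_partition ka).
Hypothesis nuN : sumn nu + k <= N.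

Let mx i := maxn (pt nu i) (pt ka i).
Let mn i := minn (pt nu i) (pt ka i).
Let M := (size nu + size ka).

(* Row [i] of [mu] and row [i.+1] of [lambda] range over the same interval
   [mx i.+1, mn i], which is reflected; the free first row of [lambda] absorbs the size. *)
Definition strip_up (m : seq nat) : seq nat :=
  part_of (fun i => if i is i'.+1 then mx i + mn i' - pt m i'
                   else mx 0 + (sumn m + k - sumn ka)) M.+1.

Definition strip_down (l : seq nat) : seq nat :=
  part_of (fun i => mx i.+1 + mn i - pt l i.+1) M.

Let lowset m := [&& hstrip nu m, hstrip ka m & sumn ka <= sumn m + k].
Let upset l := [&& hstrip l nu, hstrip l ka & sumn l == sumn nu + k].

Let mx0 i : M <= i -> mx i = 0.
Proof. by move=> h; rewrite /mx !nth_default //; lia. Qed.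

Let mn0 i : M <= i -> mn i = 0.
Proof. by move=> h; rewrite /mn !nth_default //; lia. Qed.

Let mxd i : mx i.+1 <= mx i.
Proof. by rewrite /mx; move: (part_step i pnu) (part_step i pka); lia. Qed.
Let mnx i : mn i <= mx i.
Proof. by rewrite /mx /mn; lia. Qed.
Let mnd i : mn i.+1 <= mn i.
Proof. by rewrite /mn; move: (part_step i pnu) (part_step i pka); lia. Qed.

Let lowE m : hstrip nu m -> hstrip ka m -> forall i, mx i.+1 <= pt m i <= mn i.
Proof. by move=> /hstripP h1 /hstripP h2 i; rewrite /mx /mn; move: (h1 i) (h2 i); lia. Qed.

Let upE l : hstrip l nu -> hstrip l ka -> forall i, mx i <= pt l i /\ pt l i.+1 <= mn i.
Proof. by move=> /hstripP h1 /hstripP h2 i; rewrite /mx /mn; move: (h1 i) (h2 i); lia. Qed.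

Let nth_up m : hstrip nu m -> hstrip ka m -> forall i,
  pt (strip_up m) i = if i is i'.+1 then mx i + mn i' - pt m i' else mx 0 + (sumn m + k - sumn ka).
Proof.
move=> h1 h2 i; have h := lowE h1 h2.
rewrite nth_part_of // => [[|j]|[|j]] //.
- by move: (h 0) (mnx 0) (mxd 0); lia.
- by move: (h j) (h j.+1) (mnx j.+1) (mxd j.+1); lia.
- by move=> hj; rewrite mx0 ?mn0 //; lia.
Qed.

Let part_up m : hstrip nu m -> hstrip ka m -> is_partition (strip_up m).
Proof.
move=> h1 h2; have h := lowE h1 h2; apply: part_of_part => -[|j].
- by move: (h 0) (mnx 0) (mxd 0); lia.
- by move: (h j) (h j.+1) (mnx j.+1) (mxd j.+1); lia.
Qed.

Let nth_down l : hstrip l nu -> hstrip l ka -> forall i, pt (strip_down l) i = mx i.+1 + mn i - pt l i.+1.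
Proof.
move=> h1 h2 i; have h := upE h1 h2.
rewrite nth_part_of // => j; first by move: (h j) (h j.+1) (h j.+2) (mnx j.+1) (mnd j) (mxd j.+1); lia.
by move=> hj; rewrite mx0 ?mn0 //; lia.
Qed.

Let part_down l : hstrip l nu -> hstrip l ka -> is_partition (strip_down l).
Proof.
move=> h1 h2; have h := upE h1 h2; apply: part_of_part => j.
by move: (h j) (h j.+1) (h j.+2) (mnx j.+1) (mnd j) (mxd j.+1); lia.
Qed.

Let size_le s t : is_partition s -> (forall i, pt s i <= pt t i) -> size s <= size t.
Proof.
move=> ps h; have := pt_gt0 (size t) ps; have := h (size t).
by rewrite [pt t _]nth_default //; lia.
Qed.

Let sumM : \sum_(i < M.+1) mx i + \sum_(i < M.+1) mn i = sumn nu + sumn ka.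
Proof.
rewrite (@sumn_nth nu M.+1) ?(@sumn_nth ka M.+1); try by rewrite /M; lia.
by rewrite -!big_split; apply: eq_bigr => i _ /=; rewrite /mx /mn; lia.
Qed.

(** Summed over all rows, [mx] and [mn] give the sizes of [nu] and [ka]; only [pt l 0] and [mx 0]
    remain unpaired by the reflection. *)
Let sum_shift (l m : seq nat) : is_partition l -> is_partition m -> hstrip l nu -> hstrip nu m ->
  (forall i, pt l i.+1 + pt m i = mx i.+1 + mn i) ->
  sumn l + sumn m + mx 0 = pt l 0 + sumn nu + sumn ka.
Proof.
move=> pl pm h1 h2 e.
have sm : size m <= M.+1.
  by apply: leq_trans (size_le pm (hstrip_sub h2)) _; rewrite /M; lia.
have sl : size l <= M.+2.
  have := pt_gt0 M.+1 pl; move/hstripP: h1 => /(_ M); rewrite (nth_default _ (_ : size nu <= M)); first lia.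
  by rewrite /M; lia.
rewrite (sumn_nth sm) (sumn_nth sl) big_ord_recl -!addnA; congr (_ + _).
rewrite -sumM.
have -> : \sum_(i < M.+1) mx i = mx 0 + \sum_(i < M.+1) mx i.+1.
  by rewrite big_ord_recl [in RHS]big_ord_recr /= (@mx0 M.+1) ?addn0.
rewrite addnA -big_split /= addnC -addnA -big_split; congr (_ + _).
by apply: eq_bigr => i _ /=; rewrite e.
Qed.

Let up_mem m : is_partition m -> lowset m -> is_partition (strip_up m) && upset (strip_up m).
Proof.
move=> pm /and3P[h1 h2 h3]; have h := lowE h1 h2; have nu_ := nth_up h1 h2.
have pu := part_up h1 h2.
have h4 : hstrip (strip_up m) nu.
  by apply/hstripP=> -[|i]; rewrite !nu_; [move: (h 0) (mxd 0)|move: (h i) (h i.+1)]; rewrite /mx /mn; lia.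
have h5 : hstrip (strip_up m) ka.
  by apply/hstripP=> -[|i]; rewrite !nu_; [move: (h 0) (mxd 0)|move: (h i) (h i.+1)]; rewrite /mx /mn; lia.
rewrite pu /upset h4 h5 /=.
have := sum_shift pu pm h4 h1 _; rewrite nu_ => E.
apply/eqP; have : sumn (strip_up m) + sumn m + mx 0 = mx 0 + (sumn m + k - sumn ka) + sumn nu + sumn ka.
  by apply: E => i; rewrite nu_; move: (h i); lia.
lia.
Qed.

Let down_mem l : is_partition l -> upset l -> is_partition (strip_down l) && lowset (strip_down l).
Proof.
move=> pl /and3P[h1 h2 /eqP h3]; have h := upE h1 h2; have nd := nth_down h1 h2.
have pd := part_down h1 h2.
have h4 : hstrip nu (strip_down l).
  by apply/hstripP=> i; rewrite nd; move: (h i) (h i.+1); rewrite /mx /mn; lia.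
have h5 : hstrip ka (strip_down l).
  by apply/hstripP=> i; rewrite nd; move: (h i) (h i.+1); rewrite /mx /mn; lia.
rewrite pd /lowset h4 h5 /=.
have E : sumn l + sumn (strip_down l) + mx 0 = pt l 0 + sumn nu + sumn ka.
  by apply: sum_shift => // i; rewrite nd; move: (h i) (h i.+1); lia.
by move: (h 0); lia.
Qed.

Let upK m : is_partition m -> lowset m -> strip_down (strip_up m) = m.
Proof.
move=> pm hm; have /andP[pu /and3P[h4 h5 _]] := up_mem pm hm.
case/and3P: hm => h1 h2 _; apply: part_ext => // [|i]; first exact: part_down.
by rewrite nth_down // nth_up //; move: (lowE h1 h2 i); lia.
Qed.

Let downK l : is_partition l -> upset l -> strip_up (strip_down l) = l.
Proof.
move=> pl hl; have /andP[pd /and3P[h4 h5 h6]] := down_mem pl hl.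
case/and3P: hl => h1 h2 /eqP h3; have h := upE h1 h2; have nd := nth_down h1 h2.
apply: part_ext => // [|[|i]]; first exact: part_up.
  have E : sumn l + sumn (strip_down l) + mx 0 = pt l 0 + sumn nu + sumn ka.
    by apply: sum_shift => // i; rewrite nd; move: (h i) (h i.+1); lia.
  rewrite nth_up //.
  by move: (h 0); lia.
by rewrite nth_up // nd; move: (h i) (h i.+1); lia.
Qed.

(** The intermediate shapes between [nu] and [ka] are counted for both orders of removing and adding
    strips. The inequality in [lowset] says that the first row of [strip_up] exceeds [mx 0] by a
    true, untruncated difference. *)
Lemma local_rule_count : count lowset (partitions_le N) = count upset (partitions_le N).
Proof.
rewrite -!size_filter -(size_map strip_up); apply: perm_size; apply: uniq_perm.
- rewrite map_inj_in_uniq; first exact: filter_uniq (partitions_le_uniq N).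
  move=> a b.
  rewrite mem_filter => /andP[ha /partitions_le_part pa]; rewrite mem_filter => /andP[hb /partitions_le_part pb] e.
  by rewrite -(upK pa ha) e upK.
- exact: filter_uniq (partitions_le_uniq N).
move=> l; rewrite mem_filter mem_partitions_le; apply/mapP/idP.
  case=> m; rewrite mem_filter => /andP[hm /partitions_le_part pm ->].
  by case/andP: (up_mem pm hm) => -> /[dup] /and3P[_ _ /eqP->] ->.
case/and3P=> hl pl _; exists (strip_down l); last by rewrite downK.
have /andP[pd hd] := down_mem pl hl; rewrite mem_filter hd mem_partitions_le pd /=.
by case/and3P: hd => /hstrip_sumn; lia.
Qed.

End LocalRule.

Section Pieri.

Variables (R : comNzRingType) (x : nat -> R) (N : nat).

(** The Schur polynomial of [nu] in [x 0, ..., x k.-1], defined by its branching rule: the boxes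
    with the largest entry form a horizontal strip. This makes induction on the number of variables
    available. *)
Fixpoint schur_branch k nu : R :=
  if k is k'.+1 then (\sum_(m <- partitions_le N | hstrip nu m) x k' ^+ (sumn nu - sumn m)%N * schur_branch k' m)%R
  else (nu == [::])%:R%R.

(** The complete homogeneous polynomial of degree [a] in the same variables. *)
Fixpoint hsym k a : R :=
  if k is k'.+1 then (\sum_(j < a.+1) x k' ^+ j * hsym k' (a - j)%N)%R else (a == 0)%:R%R.

Lemma exchange_count (T : eqType) (s : seq T) (P : pred T) (Q : T -> pred T) (G : T -> R) :
  (\sum_(m <- s | P m) \sum_(c <- s | Q m c) G c =
   \sum_(c <- s) G c *+ count (fun m => P m && Q m c) s)%R.
Proof.
rewrite (exchange_big_dep xpredT) //=; apply: eq_bigr => c _.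
by rewrite big_const_seq iter_addr addr0.
Qed.

(** Splitting off the last variable on both sides leaves sums over the same shapes [c] of the same
    term, weighted by the number of intermediate shapes; these numbers agree by
    [local_rule_count]. *)
Lemma pieri k nu a : is_partition nu -> sumn nu + a <= N ->
  (schur_branch k nu * hsym k a = \sum_(l <- partitions_le N | hstrip l nu && (sumn l == sumn nu + a)%N) schur_branch k l)%R.
Proof.
elim: k nu a => [|k IH] nu a pnu nuN /=.
  have [->|nu0] := eqVneq nu [::]; last first.
    rewrite mul0r big1_seq // => l /andP[/andP[hl _] _].
    case: eqP => // l0; case/eqP: nu0; apply: part_sumn0 => //.
    by move/hstrip_sumn: hl; rewrite l0 /=; lia.
  have [->|a0] := eqVneq a 0.
    rewrite mul1r big_mkcond (bigD1_seq [::]) ?partitions_le_uniq ?mem_partitions_le //= big1 ?addr0 // => l /negPf->.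
    by rewrite if_same.
  rewrite mulr0 big1 // => l /andP[_ /eqP sl].
  by case: eqP => // l0; move: sl; rewrite l0 /=; lia.
(* The exponent depends on [c] alone: branching contributes [sumn nu - sumn m], the complete
   polynomial contributes [j], and [sumn c = sumn m + (a - j)]. *)
pose G c := (x k ^+ (sumn nu + a - sumn c)%N * schur_branch k c)%R.
transitivity (\sum_(m <- partitions_le N | hstrip nu m)
   \sum_(c <- partitions_le N | hstrip c m && (sumn c <= sumn m + a)%N) G c)%R.
  rewrite big_distrl /= big_seq_cond [RHS]big_seq_cond; apply: eq_bigr => m.
  case/andP=> /partitions_le_part pm hm; have mn := hstrip_sumn hm.
  rewrite big_distrr /=.
  transitivity (\sum_(j < a.+1) \sum_(c <- partitions_le N | hstrip c m && (sumn c == sumn m + (a - j))%N) G c)%R.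
    apply: eq_bigr => -[j ja] _ /=; rewrite mulrACA -exprD IH //; last lia.
    rewrite big_distrr; apply: eq_bigr => c /andP[_ /eqP cE] /=.
    by rewrite /G; congr (x k ^+ _ * _)%R; lia.
  rewrite (exchange_big_dep (fun c => hstrip c m && (sumn c <= sumn m + a))) /=; last first.
    by move=> j c _ /andP[-> /eqP->]; lia.
  apply: eq_bigr => c /andP[hc cma]; have mc := hstrip_sumn hc.
  have ja : sumn m + a - sumn c < a.+1 by lia.
  rewrite (big_pred1 (Ordinal ja)) // => -[j jlt]; rewrite /= hc -val_eqE /=; lia.
have -> : (\sum_(l <- partitions_le N | hstrip l nu && (sumn l == sumn nu + a)%N)
    \sum_(m <- partitions_le N | hstrip l m) x k ^+ (sumn l - sumn m)%N * schur_branch k m =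
  \sum_(l <- partitions_le N | hstrip l nu && (sumn l == sumn nu + a)%N)
    \sum_(m <- partitions_le N | hstrip l m) G m)%R.
  by apply: eq_bigr => l /andP[_ /eqP lE]; apply: eq_bigr => m _; rewrite /G lE.
rewrite !exchange_count big_seq [RHS]big_seq; apply: eq_bigr => c /partitions_le_part pc.
congr (_ *+ _)%R; rewrite (local_rule_count pnu pc nuN).
by apply: eq_count => l /=; rewrite -andbA [(_ == _) && _]andbC.
Qed.

End Pieri.

(** * Counting chains *)

(* [r] together with the [b] lowest boxes of the strip [l/r]. *)
Definition bottom_boxes (l r : seq nat) b : seq nat :=
  part_of (fun k => pt r k + minn b (tl l k - tl r k) - minn b (tl l k.+1 - tl r k.+1)) (size l).

Lemma tail_sub l r k : (forall i, pt r i <= pt l i) -> tl r k <= tl l k.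
Proof. by move=> h; apply: sum_le_sub => i; rewrite !nth_drop. Qed.

Lemma hstrip_size l r : hstrip l r -> is_partition l -> is_partition r -> size r <= size l.
Proof.
move=> hlr pl pr; have := pt_gt0 (size l) pr; have := hstrip_sub hlr (size l).
by rewrite [pt l _]nth_default //; lia.
Qed.

Lemma bottom_boxes_spec l r a b (m := bottom_boxes l r b) : is_partition l -> is_partition r -> hstrip l r ->
  sumn l = sumn r + a + b ->
  [/\ is_partition m, hstrip l m /\ hstrip m r, sumn l = sumn m + a, sumn m = sumn r + b & ~~ strip_descent l m r].
Proof.
move=> pl pr hlr sl.
have sub := hstrip_sub hlr.
have szr := hstrip_size hlr pl pr.
pose d k := tl l k - tl r k.
have dE k : d k + pt r k = pt l k + d k.+1.
  rewrite /d; move: (tailE l k) (tailE r k) (tail_sub k sub) (tail_sub k.+1 sub) (sub k); lia.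
have d0 k : size l <= k -> d k = 0 by move=> h; rewrite /d !drop_oversize //; lia.
pose f k := pt r k + minn b (d k) - minn b (d k.+1).
have fb k : pt r k <= f k <= pt l k by rewrite /f; move: (dE k) (sub k); lia.
have fd k : f k.+1 <= f k.
  by move/hstripP: hlr => /(_ k); move: (fb k) (fb k.+1); lia.
have f0 k : size l <= k -> f k = 0.
  by move=> h; move: (fb k); rewrite (nth_default _ h); lia.
have mE k : pt m k = f k by apply: nth_part_of.
have pm : is_partition m by apply: part_of_part.
have szm : size m <= size l.
  by have := pt_gt0 (size l) pm; rewrite mE f0 //; lia.
have h1 : hstrip l m.
  by apply/hstripP=> k; rewrite mE; move/hstripP: hlr => /(_ k); move: (fb k); lia.
have h2 : hstrip m r.
  by apply/hstripP=> k; rewrite !mE; move/hstripP: hlr => /(_ k); move: (fb k) (fb k.+1); lia.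
have sm : sumn m = sumn r + b.
  have := @tail_unique m (fun k => tl r k + minn b (d k)) (size l) szm _ _ 0 (leq0n _).
  rewrite !drop0 /d !drop0 => ->; first by lia.
    by rewrite -/(d _) d0 // drop_oversize //; lia.
  by move=> k; rewrite mE /f -!/(d _) (tailE r k); move: (dE k) (sub k); lia.
split=> //; first lia.
apply/strip_descentP => -[i [j [ij hi hj]]].
have strip_tail : d j <= d i.+1.
  elim: j ij {hj} => // j IHj; rewrite ltnS leq_eqVlt => /predU1P[->//|/IHj].
  by move: (dE j) (sub j); lia.
by move: hi hj; rewrite !mE /f; move: (dE i) (dE j) (sub i) (sub j); lia.
Qed.

(** If [m/r] has a box above row [k], the absence of a descent makes [l] and [m] agree from [k] on;
    if it has none, all its [b] boxes lie there. Either way the tail of [m] at [k] is forced. *)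
Lemma bottom_boxes_unique l r m a b : is_partition l -> is_partition r -> is_partition m ->
  hstrip l m -> hstrip m r -> sumn l = sumn m + a -> sumn m = sumn r + b -> ~~ strip_descent l m r ->
  hstrip l r /\ m = bottom_boxes l r b.
Proof.
move=> pl pr pm h1 h2 s1 s2 /strip_descentP nd.
have sub1 := hstrip_sub h1; have sub2 := hstrip_sub h2.
have D k : tl m k = tl r k + minn b (tl l k - tl r k).
  have [hk|hk] := boolP (has (fun i => pt r i < pt m i) (iota 0 k)).
    case/hasP: hk => i; rewrite mem_iota /= add0n => ik hi.
    have -> : tl l k = tl m k.
      apply/eqP; rewrite eqn_leq; apply/andP; split; apply: sum_le_sub => j; rewrite !nth_drop //.
      by rewrite leqNgt; apply/negP => hj; apply: nd; exists i, (k + j); split=> //; lia.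
    have : tl m k <= tl r k + b; last by move: (tail_sub k sub2); lia.
    move: s2; rewrite -{1}(cat_take_drop k m) -{1}(cat_take_drop k r) !sumn_cat.
    suff : sumn (take k r) <= sumn (take k m) by lia.
    apply: sum_le_sub => j; case: (ltnP j k) => jk; first by rewrite !nth_take.
    by rewrite !nth_default // size_take_min; lia.
  have e : sumn (take k m) = sumn (take k r).
    apply/eqP; rewrite eqn_leq; apply/andP; split; apply: sum_le_sub => j.
      case: (ltnP j k) => jk; last by rewrite !nth_default // size_take_min; lia.
      rewrite !nth_take // leqNgt; apply: contra hk => hj.
      by apply/hasP; exists j => //; rewrite mem_iota.
    case: (ltnP j k) => jk; first by rewrite !nth_take.
    by rewrite !nth_default // size_take_min; lia.
  move: s2; rewrite -{1}(cat_take_drop k m) -{1}(cat_take_drop k r) !sumn_cat e.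
  by move: (tail_sub k sub1) (tail_sub k sub2); lia.
have hlr : hstrip l r.
  apply/hstripP=> i; move/hstripP: h1 => /(_ i) h1; move/hstripP: h2 => /(_ i) h2.
  apply/andP; split; last by lia.
  have [hi|hi] := ltnP (pt r i) (pt m i); last by lia.
  have : pt l i.+1 <= pt m i.+1; last by lia.
  by rewrite leqNgt; apply/negP => hj; apply: nd; exists i, i.+1; split.
split=> //.
have sl : sumn l = sumn r + a + b by lia.
have [pm' _ _ _ _] := bottom_boxes_spec pl pr hlr sl.
apply: part_ext => // i.
rewrite nth_part_of; last 2 first.
- move=> k; move/hstripP: h1 => /(_ k) h1; move/hstripP: h2 => /(_ k) h2.
  have := D k; have := D k.+1; have := D k.+2; have := tailE m k; have := tailE m k.+1.
  have := tailE r k; have := tailE r k.+1.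
  by have := part_step k pm; lia.
- by move=> k hk; rewrite nth_default ?drop_oversize //; have := hstrip_size hlr pl pr; lia.
by have := D i; have := D i.+1; have := tailE m i; have := tailE r i; lia.
Qed.

(** [m/r] is nonempty and consists of lowest boxes of [l/r], so both strips have the same lowest
    row, which is all a descent from [r/t] depends on. *)
Lemma strip_descent_merge l m r t b : hstrip l m -> hstrip m r -> sumn m = sumn r + b -> 0 < b ->
  ~~ strip_descent l m r -> strip_descent m r t = strip_descent l r t.
Proof.
move=> h1 h2 sm b0 /strip_descentP nd; have sub1 := hstrip_sub h1; have sub2 := hstrip_sub h2.
apply/strip_descentP/strip_descentP => -[i [j [ij hi hj]]].
  by exists i, j; split=> //; move: (sub1 j); lia.
have [hm|hm] := ltnP (pt r j) (pt m j); first by exists i, j.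
have [j1 hj1] : exists j1, pt r j1 < pt m j1.
  have [/hasP[j1 _ h]|/hasPn h] := boolP (has (fun j => pt r j < pt m j) (iota 0 (size m))).
    by exists j1.
  have : sumn m <= sumn r; last lia.
  apply: sum_le_sub => k; have [km|km] := ltnP k (size m); last by rewrite nth_default.
  by rewrite leqNgt; apply: h; rewrite mem_iota.
exists i, j1; split=> //; apply: (leq_trans ij).
rewrite leqNgt; apply/negP => lt; apply: nd; exists j1, j; split=> //; lia.
Qed.

Lemma big_seq_single (T : eqType) (s : seq T) (P : pred T) (F : T -> nat) j :
  uniq s -> j \in s -> P j -> (forall i, i \in s -> P i -> i = j) ->
  \sum_(i <- s | P i) F i = F j.
Proof.
move=> us sj Pj h; rewrite big_mkcond (bigD1_seq j) //= Pj big1_seq ?addn0 // => i.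
by case/andP=> ij si; case: ifP => // /(h _ si) e; rewrite e eqxx in ij.
Qed.

Section Coefficients.

Variable N : nat.

Fixpoint strip_count (L : seq (nat * bool)) (l m : seq nat) : nat :=
  if L is (a, e) :: L' then
    (hstrip l m && (sumn l == sumn m + a)) * \sum_(r <- partitions_le N | e ==> strip_descent l m r) strip_count L' m r
  else (l == [::]) && (m == [::]).

Definition chain_count L l := \sum_(m <- partitions_le N) strip_count L l m.

Lemma sum_gt0 (T : eqType) (s : seq T) (P : pred T) (F : T -> nat) :
  0 < \sum_(i <- s | P i) F i <-> exists2 i, i \in s & P i && (0 < F i).
Proof.
rewrite lt0n sum_nat_seq_neq0; split.
  by case/hasP=> i si /=; rewrite -lt0n => h; exists i.
by case=> i si h; apply/hasP; exists i; rewrite //= -lt0n.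
Qed.

Lemma strip_count_gt0 L l m : is_partition m -> sumn m <= N -> 0 < strip_count L l m <-> ribbon_chain L l m.
Proof.
elim: L l m => [|[a e] L IH] l m pm mN /=.
  by rewrite lt0b; split=> [/andP[/eqP-> /eqP->]|[-> ->]].
rewrite muln_gt0 lt0b; split.
  case/andP=> /andP[hlm /eqP sl] /sum_gt0[r rN /andP[/implyP er h]].
  move: (rN); rewrite mem_partitions_le => /andP[pr rN'].
  by split=> //; exists r => //; apply/IH.
case=> _ hlm sl [r Cr er]; rewrite hlm sl eqxx /=; apply/sum_gt0.
have [pr hmr] : is_partition r /\ sumn r <= sumn m.
  by case: (L) Cr => [[-> ->] //|[b e'] L' [? /hstrip_sumn]].
exists r; first by rewrite mem_partitions_le pr (leq_trans hmr).
apply/andP; split; first by apply/implyP.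
by apply/IH => //; apply: leq_trans mN.
Qed.

Lemma chain_count_gt0 L l : is_partition l -> sumn l <= N -> 0 < chain_count L l <-> exists m, ribbon_chain L l m.
Proof.
move=> pl lN; split=> [/sum_gt0[m mN /= h]|[m Cm]].
  by move: mN; rewrite mem_partitions_le => /andP[pm mN]; exists m; apply/strip_count_gt0.
have [pm hlm] : is_partition m /\ sumn m <= sumn l.
  by case: (L) Cm => [[-> ->] //|[b e'] L' [? /hstrip_sumn]].
apply/sum_gt0; exists m; first by rewrite mem_partitions_le pm (leq_trans hlm).
by apply/strip_count_gt0 => //; apply: leq_trans lN.
Qed.

Lemma chain_count_free a L l :
  chain_count ((a, false) :: L) l = \sum_(m <- partitions_le N | hstrip l m && (sumn l == sumn m + a)) chain_count L m.
Proof.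
rewrite /chain_count /= [RHS]big_mkcond; apply: eq_bigr => m _ /=.
by case: (_ && _); rewrite ?mul1n ?mul0n.
Qed.

Lemma chain_count_merge a b e L l : 0 < b -> is_partition l -> sumn l <= N ->
  chain_count ((a, true) :: (b, e) :: L) l + chain_count ((a + b, e) :: L) l = chain_count ((a, false) :: (b, e) :: L) l.
Proof.
move=> b0 pl lN; rewrite /chain_count /=.
pose K m r := \sum_(t <- partitions_le N | e ==> strip_descent m r t) strip_count L r t.
pose C m r := [&& hstrip l m, sumn l == sumn m + a, hstrip m r & sumn m == sumn r + b].
have E P : \sum_(m <- partitions_le N) (hstrip l m && (sumn l == sumn m + a)) *
    (\sum_(r <- partitions_le N | P m r) (hstrip m r && (sumn m == sumn r + b)) * K m r) =
  \sum_(r <- partitions_le N) \sum_(m <- partitions_le N | P m r && C m r) K m r.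
  rewrite [RHS](exchange_big_dep xpredT) //=; apply: eq_bigr => m _.
  rewrite big_distrr /= big_mkcond [RHS]big_mkcond; apply: eq_bigr => r _.
  rewrite /C; case: (P m r) => //; case: (hstrip l m); case: (sumn l == _); case: (hstrip m r);
  by case: (_ == _); rewrite /= ?mul1n ?mul0n.
rewrite !E -/K -big_split [LHS]big_seq [RHS]big_seq; apply: eq_bigr => r rN /=.
have /andP[pr rN'] : is_partition r && (sumn r <= N) by rewrite -mem_partitions_le.
rewrite [RHS](bigID (fun m => strip_descent l m r)) /=; congr (_ + _).
  by apply: eq_bigl => m; rewrite andbC.
rewrite -/(K l r) addnA [sumn r + a + b]addnAC -[sumn r + b + a]addnAC.
have [hlr|hlr] := boolP (hstrip l r && (sumn l == sumn r + a + b)); last first.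
  rewrite mul0n big1_seq // => m /andP[/andP[/and4P[h1 /eqP s1 h2 /eqP s2] nd] mN].
  have [h3 _] := bottom_boxes_unique pl pr (partitions_le_part mN) h1 h2 s1 s2 nd.
  by case/negP: hlr; rewrite h3 /=; lia.
case/andP: hlr => hlr /eqP sl.
have [pm [h1 h2] s1 s2 nd] := bottom_boxes_spec pl pr hlr sl.
rewrite mul1n (@big_seq_single _ _ _ _ (bottom_boxes l r b)) ?partitions_le_uniq //.
- by apply: eq_bigl => t; rewrite (strip_descent_merge t h1 h2 s2 b0 nd).
- by rewrite mem_partitions_le pm; lia.
- by rewrite /C h1 h2 -s1 -s2 !eqxx.
- move=> m mN /andP[/and4P[h3 /eqP s3 h4 /eqP s4] nd'].
  by have [] := bottom_boxes_unique pl pr (partitions_le_part mN) h3 h4 s3 s4 nd'.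
Qed.

End Coefficients.

(** * Ribbon polynomials in the Schur basis *)

Section RibbonExpansion.

Variables (R : comNzRingType) (x : nat -> R) (N : nat).

Fixpoint ribbon_sum k a (e : bool) (L : seq (nat * bool)) : R :=
  if L is (b, e') :: L' then
    (hsym x k a * ribbon_sum k b e' L' - (if e then ribbon_sum k (a + b)%N e' L' else 0))%R
  else hsym x k a.

Lemma schur_branch_nil k : schur_branch x N k [::] = 1%R.
Proof.
elim: k => [|k IH] //=; rewrite big_mkcond (bigD1_seq [::]) ?partitions_le_uniq ?mem_partitions_le //=.
rewrite expr0 mul1r IH big1_seq ?addr0 // => m /andP[m0 /partitions_le_part pm].
case: ifP => // hm; case/eqP: m0; apply: part_sumn0 => //.
by move/hstrip_sumn: hm; rewrite /=; lia.
Qed.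

Lemma expand_free k a L n : n + a <= N ->
  (\sum_(l <- partitions_le N | (sumn l == n + a)%N) (chain_count N ((a, false) :: L) l)%:R * schur_branch x N k l =
   hsym x k a * \sum_(m <- partitions_le N | sumn m == n) (chain_count N L m)%:R * schur_branch x N k m)%R.
Proof.
move=> naN; rewrite big_distrr /=.
transitivity (\sum_(m <- partitions_le N | sumn m == n)
  \sum_(l <- partitions_le N | hstrip l m && (sumn l == sumn m + a)%N) (chain_count N L m)%:R * schur_branch x N k l)%R; last first.
  rewrite big_seq_cond [RHS]big_seq_cond; apply: eq_bigr => m /andP[mN /eqP sm].
  rewrite -big_distrr /= -pieri ?(partitions_le_part mN) //; last lia.
  by rewrite [RHS]mulrC mulrA.
rewrite (exchange_big_dep (fun l => sumn l == n + a)%N) /=; last by move=> m l /eqP<- /andP[].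
apply: eq_bigr => l /eqP sl; rewrite chain_count_free natr_sum big_distrl /=.
by apply: eq_bigl => m; rewrite sl eqn_add2r eq_sym andbC; case: eqP => // ->; rewrite eqxx andbT.
Qed.

Lemma chain_count_nil l : chain_count N [::] l = (l == [::]).
Proof.
rewrite /chain_count /=; rewrite (bigD1_seq [::]) ?partitions_le_uniq ?mem_partitions_le //= andbT.
by rewrite big1 ?addn0 // => m /negPf->; rewrite andbF.
Qed.

(** The merged ribbon has fewer rows, so induction covers both terms of the recursion. The condition
    on [last] concerns the top row: a flag there would admit no chain, while [ribbon_sum] would
    ignore it. *)
Lemma ribbon_sum_expand k a e L : all (fun b => 0 < b.1) L -> ~~ last e (unzip2 L) ->
  a + sumn (unzip1 L) <= N ->
  (ribbon_sum k a e L = \sum_(l <- partitions_le N | (sumn l == a + sumn (unzip1 L))%N)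
                   (chain_count N ((a, e) :: L) l)%:R * schur_branch x N k l)%R.
Proof.
elim: L a e => [|[b e'] L IH] a e /=.
  move=> _ /negPf-> aN; have /= := @expand_free k a [::] 0 ltac:(lia).
  rewrite add0n addn0 => ->.
  rewrite big_mkcond (bigD1_seq [::]) ?partitions_le_uniq ?mem_partitions_le //= big1_seq ?addr0.
    by rewrite chain_count_nil schur_branch_nil !mulr1.
  by move=> m /andP[/negPf m0 _]; rewrite chain_count_nil m0 mul0r if_same.
case/andP=> b0 aL le aN.
have E : (hsym x k a * ribbon_sum k b e' L = \sum_(l <- partitions_le N | (sumn l == a + (b + sumn (unzip1 L)))%N)
   (chain_count N ((a, false) :: (b, e') :: L) l)%:R * schur_branch x N k l)%R.
  by rewrite IH //; [rewrite [in RHS](addnC a) expand_free //; lia | lia].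
case: e => /=; last by rewrite subr0.
rewrite E IH //; last by rewrite -addnA.
rewrite -addnA -sumrB big_seq_cond [RHS]big_seq_cond; apply: eq_bigr => l /andP[lN _].
move: (lN); rewrite mem_partitions_le => /andP[pl lN'].
by rewrite -(chain_count_merge a e' L b0 pl lN') natrD mulrDl addrK.
Qed.

End RibbonExpansion.

(** * Tableaux and branching *)

Section Boxes.

Variables lam mu : seq nat.
Hypothesis plam : is_partition lam.
Implicit Type b : box lam mu.

Definition coord b := (brow b, bcol b).

Lemma coord_inj : injective coord.
Proof.
move=> [[i j] h] [[i' j'] h'] [/= e1 e2]; apply: val_inj => /=.
by congr pair; apply: val_inj.
Qed.

Lemma box_in b : in_skew lam mu (brow b) (bcol b).
Proof. exact: (valP b). Qed.

Lemma box_ex r c : in_skew lam mu r c -> exists b, coord b = (r, c).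
Proof.
move=> h; have /andP[_ hc] := h.
have hr : r < size lam by rewrite -pt_gt0 //; lia.
have hc0 : c < pt lam 0 by apply: leq_trans hc _; apply: part_mono.
by exists (exist (fun b : 'I_(size lam) * 'I_(pt lam 0) => in_skew lam mu b.1 b.2)
  (Ordinal hr, Ordinal hc0) h).
Qed.

Definition cells (rs : seq nat) : seq (nat * nat) :=
  flatten [seq [seq (i, j) | j <- iota (pt mu i) (pt lam i - pt mu i)] | i <- rs].

Lemma mem_cells rs i j : ((i, j) \in cells rs) = (i \in rs) && in_skew lam mu i j.
Proof.
apply/flatten_mapP/andP => [[i' hi' /mapP[j' hj' [-> ->]]]|[hi hj]].
  by split=> //; move: hj'; rewrite mem_iota /in_skew; lia.
by exists i => //; apply: map_f; rewrite mem_iota; move: hj; rewrite /in_skew; lia.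
Qed.

Lemma cells_uniq rs : uniq rs -> uniq (cells rs).
Proof.
elim: rs => //= i rs IH /andP[ni /IH ur]; rewrite cat_uniq ur andbT.
rewrite map_inj_uniq ?iota_uniq /=; last by move=> j j' [].
apply/hasPn => -[i' j]; rewrite mem_cells => /andP[hi' _].
by apply/negP => /mapP[j' _ [e _]]; rewrite -e hi' in ni.
Qed.

Lemma cells_perm rs : perm_eq rs (iota 0 (size lam)) ->
  perm_eq (map coord (enum {: box lam mu})) (cells rs).
Proof.
move=> prs; apply: uniq_perm.
- by rewrite map_inj_uniq ?enum_uniq //; apply: coord_inj.
- by apply: cells_uniq; rewrite (perm_uniq prs) iota_uniq.
move=> [i j]; rewrite mem_cells (perm_mem prs); apply/mapP/andP.
  case=> b _ [-> ->]; split; last exact: box_in.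
  by rewrite mem_iota /= add0n /brow.
by case=> _ /box_ex[b eb]; exists b; rewrite ?mem_enum.
Qed.

Lemma big_box (V : Type) (idx : V) (op : Monoid.com_law idx) (F : nat -> nat -> V) :
  \big[op/idx]_(b : box lam mu) F (brow b) (bcol b) =
  \big[op/idx]_(i <- iota 0 (size lam))
    \big[op/idx]_(j <- iota (pt mu i) (pt lam i - pt mu i)) F i j.
Proof.
transitivity (\big[op/idx]_(q <- cells (iota 0 (size lam))) F q.1 q.2).
  by rewrite -(perm_big _ (cells_perm (perm_refl _))) big_map big_enum.
by rewrite /cells big_flatten big_map; apply: eq_bigr => i _; rewrite big_map.
Qed.

Definition entry n (T : {ffun box lam mu -> 'I_n}) i j : nat :=
  if [pick b | coord b == (i, j)] is Some b then T b else 0.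

Lemma entryE n (T : {ffun box lam mu -> 'I_n}) b : entry T (brow b) (bcol b) = T b.
Proof.
rewrite /entry; case: pickP => [b' /eqP /coord_inj->//|/(_ b)].
by rewrite /coord eqxx.
Qed.

Lemma entry_coord n (T : {ffun box lam mu -> 'I_n}) b i j : coord b = (i, j) -> entry T i j = T b.
Proof. by case=> <- <-; rewrite entryE. Qed.

Lemma semistandardP n (T : {ffun box lam mu -> 'I_n}) :
  reflect ((forall i j j', in_skew lam mu i j -> in_skew lam mu i j' -> j < j' ->
              entry T i j <= entry T i j') /\
           (forall i i' j, in_skew lam mu i j -> in_skew lam mu i' j -> i < i' ->
              entry T i j < entry T i' j)) (semistandard T).
Proof.
apply: (iffP 'forall_'forall_andP) => [h|[h1 h2] b b'].
  split=> [i j j' /box_ex[b /[dup] eb [<- <-]] /box_ex[b' /[dup] eb' [e <-]] jj'|].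
    by rewrite entryE -e entryE; have [/implyP h1 _] := h b b'; apply: h1; rewrite -e eqxx.
  move=> i i' j /box_ex[b /[dup] eb [<- <-]] /box_ex[b' /[dup] eb' [<- e]] jj'.
  by rewrite entryE -e entryE; have [_ /implyP h1] := h b b'; apply: h1; rewrite e eqxx.
rewrite -!entryE; split; apply/implyP=> /andP[/eqP e lt].
  by rewrite -e; apply: h1 => //; rewrite ?box_in // e box_in.
by rewrite -e; apply: h2 => //; rewrite ?box_in // e box_in.
Qed.

End Boxes.

(** A downward closed predicate holds on an initial segment, so its count is the position of its
    first failure. *)
Lemma count_down (p : pred nat) n j : (forall j, p j.+1 -> p j) ->
  (j < count p (iota 0 n)) = (j < n) && p j.
Proof.
move=> pd; have pd' i k : i <= k -> p k -> p i.
  by elim: k => [|k IH]; [case: i|rewrite leq_eqVlt => /predU1P[->//|/IH h /pd]].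
have E : count p (iota 0 n) = find (predC p) (iota 0 n).
  elim: n => // n IH; rewrite -addn1 iotaD count_cat find_cat IH /= add0n addn0.
  case: ifP => [/hasP[k]|/negbT/hasPn h].
    rewrite mem_iota /= add0n => kn nk.
    by case: (boolP (p n)) => [/(pd' _ _ (ltnW kn))|]; [rewrite (negPf nk) | rewrite addn0].
  have /hasNfind-> : ~~ has (predC p) (iota 0 n) by apply/hasPn.
  by rewrite size_iota; case: (p n).
rewrite E; apply/idP/andP => [h|[jn pj]].
  have jn : j < n by have := find_size (predC p) (iota 0 n); rewrite size_iota; lia.
  by split=> //; have := before_find 0 h; rewrite nth_iota //= => /negbFE.
rewrite ltnNge; apply/negP => h.
have hh : has (predC p) (iota 0 n) by rewrite has_find size_iota; lia.
have /= := nth_find 0 hh; rewrite nth_iota ?add0n; last by lia.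
by rewrite (pd' _ _ h pj).
Qed.

Lemma nat_ext a b : (forall j, (j < a) = (j < b)) -> a = b.
Proof. by move=> h; have := h a; have := h b; rewrite !ltnn; lia. Qed.

Fixpoint countdown k : seq nat := if k is k'.+1 then k' :: countdown k' else [::].

Section ChainSum.

Variables (R : comNzRingType) (x : nat -> R) (N : nat).

Fixpoint branch_chains k (nu : seq nat) : seq (seq (seq nat)) :=
  if k is k'.+1 then [seq m :: c | m <- [seq m <- partitions_le N | hstrip nu m], c <- branch_chains k' m]
  else if nu == [::] then [:: [::]] else [::].

Fixpoint chain_weight k (nu : seq nat) (c : seq (seq nat)) : R :=
  if k is k'.+1 then
    if c is m :: c' then (x k' ^+ (sumn nu - sumn m)%N * chain_weight k' m c')%R else 1%R
  else 1%R.

Lemma schur_branch_chains k nu : schur_branch x N k nu = (\sum_(c <- branch_chains k nu) chain_weight k nu c)%R.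
Proof.
elim: k nu => [|k IH] nu /=.
  by case: eqP => _; rewrite ?big_seq1 ?big_nil.
rewrite big_allpairs_dep big_filter; apply: eq_bigr => m _ /=.
by rewrite IH big_distrr.
Qed.

Lemma branch_chains_uniq k nu : uniq (branch_chains k nu).
Proof.
elim: k nu => [|k IH] nu /=; first by case: eqP.
apply: allpairs_uniq_dep => //; first exact: filter_uniq (partitions_le_uniq N).
by move=> [m c] [m' c'] _ _ /= [-> ->].
Qed.

Lemma mem_branch_chains k nu c : c \in branch_chains k nu <->
  exists m, [/\ m k = nu, m 0 = [::], c = map m (countdown k) &
    forall t, t < k -> hstrip (m t.+1) (m t) && (m t \in partitions_le N)].
Proof.
elim: k nu c => [|k IH] nu c /=.
  case: eqP => [->|nu0]; rewrite ?inE; split=> //.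
  - by move/eqP->; exists (fun=> [::]).
  - by case=> m [_ _ -> _].
  - by case=> m [e1 e2 _ _]; case: nu0; rewrite -e1.
split.
  case/allpairsPdep=> m0 [c' [+ /IH[m [mk m0E cE mh]] ->]].
  rewrite mem_filter => /andP[hm mN].
  exists (fun t => if t <= k then m t else nu); rewrite ltnn leqnn mk; split=> //.
    rewrite cE; congr (_ :: _).
    have : forall t, t \in countdown k -> t <= k.
      by elim: (k) => //= k' IHk t; rewrite inE => /predU1P[->//|/IHk]; lia.
    by move=> h; apply/eq_in_map => t /h ->.
  move=> t; rewrite ltnS => tk; rewrite tk; case: ltnP => [tk'|kt]; first exact: mh.
  by have -> : t = k; [lia | rewrite mk hm].
case=> m [mk m0 -> mh]; apply/allpairsPdep; exists (m k), (map m (countdown k)); split=> //.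
  by rewrite mem_filter -mk mh.
by apply/IH; exists m; split=> // t tk; apply: mh; apply: ltnW.
Qed.

End ChainSum.

Definition mvar n k : {mpoly int[n]} := if insub k is Some i then ('X_i)%R else 0%R.

Lemma mvarE n (i : 'I_n) : mvar n i = ('X_i)%R.
Proof. by rewrite /mvar valK. Qed.

Section SchurBranching.

Variables (n N : nat) (nu : seq nat).
Hypotheses (pnu : is_partition nu) (nuN : sumn nu <= N).

Let sk i j : in_skew nu [::] i j = (j < pt nu i).
Proof. by rewrite /in_skew nth_nil. Qed.

Section OneTableau.

Variable T : {ffun box nu [::] -> 'I_n}.
Hypothesis sT : semistandard T.

Definition row_count t i := count (fun j => entry T i j < t) (iota 0 (pt nu i)).
Definition shape_lt t := part_of (row_count t) (size nu).

Let rcE t i j : (j < row_count t i) = (j < pt nu i) && (entry T i j < t).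
Proof.
have [h1 _] := semistandardP pnu _ sT.
have E : row_count t i = count (fun j => (j < pt nu i) && (entry T i j < t)) (iota 0 (pt nu i)).
  by apply: eq_in_count => k; rewrite mem_iota => /andP[_]; rewrite add0n => ->.
rewrite E count_down ?andbA ?andbb // => k /andP[hk ht].
by rewrite (ltnW hk) /=; apply: leq_ltn_trans ht; apply: h1; rewrite ?sk // ltnW.
Qed.

Let rc_le t i t' i' : (forall j, j < pt nu i -> entry T i j < t ->
   (j < pt nu i') && (entry T i' j < t')) -> row_count t i <= row_count t' i'.
Proof.
move=> h; rewrite leqNgt; apply/negP => lt.
by have := lt; rewrite rcE => /andP[h1 h2]; have := h _ h1 h2; rewrite -rcE ltnn.
Qed.

Let col i j : j < pt nu i.+1 -> (j < pt nu i) /\ entry T i j < entry T i.+1 j.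
Proof.
move=> hj; have [_ h2] := semistandardP pnu _ sT.
have hj' : j < pt nu i by apply: leq_trans hj (part_step _ pnu).
by split=> //; apply: h2; rewrite ?sk.
Qed.

Let rc_step t i : row_count t i.+1 <= row_count t i.
Proof. by apply: rc_le => j /col[-> lt] /= h; apply: ltn_trans h. Qed.

Lemma part_shape_lt t : is_partition (shape_lt t).
Proof. exact: part_of_part (rc_step t). Qed.

Lemma nth_shape_lt t i : pt (shape_lt t) i = row_count t i.
Proof.
apply: nth_part_of => [k|k hk]; first exact: rc_step.
by rewrite /row_count nth_default.
Qed.

Lemma shape_ltE t i j : (j < pt (shape_lt t) i) = (j < pt nu i) && (entry T i j < t).
Proof. by rewrite nth_shape_lt rcE. Qed.

Lemma entry_lt i j : j < pt nu i -> entry T i j < n.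
Proof. by rewrite -sk => /(box_ex pnu)[b eb]; rewrite (entry_coord _ eb). Qed.

Lemma shape_lt_max : shape_lt n = nu.
Proof.
apply: part_ext => // [|i]; first exact: part_shape_lt.
apply: nat_ext => j; rewrite shape_ltE; case: (ltnP j (pt nu i)) => //= /entry_lt; exact.
Qed.

Lemma shape_lt0 : shape_lt 0 = [::].
Proof.
apply: part_ext => // [|i]; first exact: part_shape_lt.
by apply: nat_ext => j; rewrite shape_ltE ltn0 andbF nth_nil.
Qed.

Lemma shape_lt_hstrip t : hstrip (shape_lt t.+1) (shape_lt t).
Proof.
apply/hstripP=> i; rewrite !nth_shape_lt; apply/andP; split; apply: rc_le => j.
  by move=> /col[-> lt] h; apply: leq_trans lt _.
by move=> -> /= h; apply: ltnW.
Qed.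

Lemma sumn_shape_lt t : sumn (shape_lt t) = \sum_(b : box nu [::]) (T b < t).
Proof.
under eq_bigr do rewrite -entryE.
rewrite (@big_box nu [::] pnu _ _ _ (fun i j => (entry T i j < t : nat))).
have szs : size (shape_lt t) <= size nu.
  have := pt_gt0 (size nu) (part_shape_lt t); have := shape_ltE t (size nu) 0.
  by rewrite [pt nu _]nth_default //; lia.
rewrite (sumn_nth szs) -(big_mkord xpredT (fun i => pt (shape_lt t) i)) /index_iota subn0.
apply: eq_bigr => i _; rewrite nth_shape_lt /row_count nth_nil subn0.
by rewrite -sum1_count [LHS]big_mkcond; apply: eq_bigr => j _; case: (_ < _).
Qed.

Lemma shape_lt_mem t : shape_lt t \in partitions_le N.
Proof.
rewrite mem_partitions_le part_shape_lt; apply: leq_trans nuN; apply: sum_le_sub => i.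
by rewrite nth_shape_lt /row_count -{2}(size_iota 0 (pt nu i)) count_size.
Qed.

Lemma chain_weight_shape : chain_weight (mvar n) n nu (map shape_lt (countdown n)) = (\prod_b 'X_(T b))%R.
Proof.
have E k : chain_weight (mvar n) k (shape_lt k) (map shape_lt (countdown k)) =
    (\prod_(i < k) mvar n i ^+ (sumn (shape_lt i.+1) - sumn (shape_lt i))%N)%R.
  by elim: k => [|k IH] /=; rewrite ?big_ord0 // big_ord_recr /= IH mulrC.
have := E n; rewrite {1}shape_lt_max => ->.
rewrite (partition_big T xpredT) //=; apply: eq_bigr => i _.
rewrite (eq_bigr (fun=> 'X_i)%R) => [|b /eqP-> //].
rewrite prodr_const mvarE; congr (_ ^+ _)%R; rewrite !sumn_shape_lt -sum1_card.
rewrite [X in _ = X]big_mkcond /=.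
have -> : \sum_(b : box nu [::]) (T b < i.+1) =
   \sum_(b : box nu [::]) (T b < i) + \sum_(b : box nu [::]) (if T b == i then 1 else 0).
  rewrite -big_split; apply: eq_bigr => b _ /=; rewrite -val_eqE /=.
  by rewrite ltnS leq_eqVlt; case: eqP => [->|_]; rewrite ?ltnn ?addn0.
by rewrite addKn.
Qed.

End OneTableau.

Lemma chain_tableau m : m n = nu -> m 0 = [::] ->
  (forall t, t < n -> hstrip (m t.+1) (m t) && (m t \in partitions_le N)) ->
  exists2 T : {ffun box nu [::] -> 'I_n}, semistandard T & forall t, t < n -> shape_lt T t = m t.
Proof.
move=> mn m0 mh.
have mP t : t <= n -> is_partition (m t).
  by rewrite leq_eqVlt => /predU1P[->|/mh /andP[_ /partitions_le_part]//]; rewrite mn.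
have mono t t' i : t <= t' -> t' <= n -> pt (m t) i <= pt (m t') i.
  elim: t' => [|t' IH] tt' hn; first by have -> : t = 0 by lia.
  have [->//|tt''] := eqVneq t t'.+1.
  apply: leq_trans (IH _ _) _; try lia.
  by case/andP: (mh t' hn) => /hstrip_sub /(_ i).
(* The entry of box [(i, j)] is the last [t] for which the box lies outside [m t]. Since [m 0] is
   empty, [t = 0] is always counted, hence the predecessor. *)
pose f i j := (count (fun t => (t < n) && (pt (m t) i <= j)) (iota 0 n)).-1.
have fE i j t : j < pt nu i -> t <= n -> (f i j < t) = (j < pt (m t) i).
  move=> hj tn; have n0 : 0 < n.
    by case: (n) mn => // mn0; rewrite -mn0 m0 nth_nil in hj.
  have cd k := @count_down (fun t => (t < n) && (pt (m t) i <= j)) n k _.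
  have {}cd k : (k < count (fun t => (t < n) && (pt (m t) i <= j)) (iota 0 n)) = (k < n) && (pt (m k) i <= j).
    rewrite cd; first by case: (k < n).
    by move=> l /andP[ln h]; rewrite (ltnW ln) /=; apply: leq_trans (mono l l.+1 i _ _) h; lia.
  have := cd 0; rewrite n0 m0 nth_nil /= /f => c0.
  move: tn; rewrite leq_eqVlt => /predU1P[->|tn].
    by have := cd n; rewrite mn hj ltnn /=; lia.
  by have := cd t; rewrite tn /=; lia.
have fn (b : box nu [::]) : f (brow b) (bcol b) < n.
  by rewrite fE ?mn // -sk box_in.
pose T : {ffun box nu [::] -> 'I_n} := [ffun b => Ordinal (fn b)].
have tvT i j : j < pt nu i -> entry T i j = f i j.
  rewrite -sk => /(box_ex pnu)[b eb]; rewrite (entry_coord _ eb) ffunE /=.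
  by case: eb => -> ->.
have fn' i j : j < pt nu i -> f i j < n by move=> hj; rewrite fE // mn.
have sT : semistandard T.
  apply/(semistandardP pnu); split.
    move=> i j j'; rewrite !sk => hj hj' jj'; rewrite !tvT //.
    rewrite -ltnS fE //; last by rewrite fn'.
    by apply: (ltn_trans jj'); rewrite -fE //; rewrite fn'.
  move=> i i' j; rewrite !sk => hj hj' ii'; rewrite !tvT //.
  rewrite fE //; last by apply: ltnW; rewrite fn'.
  have := fn' _ _ hj'; move=> fl.
  have : j < pt (m (f i' j).+1) i' by rewrite -fE.
  case/andP: (mh _ fl) => /hstripP /(_ i) /andP[h _] _ lt.
  by apply: leq_trans lt _; apply: leq_trans _ h; apply: part_mono => //; apply: mP.
exists T => // t tn; apply: part_ext => [||i]; [exact: part_shape_lt | by apply: mP; lia |].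
apply: nat_ext => j; rewrite shape_ltE //; case: (ltnP j (pt nu i)) => hj /=.
  by rewrite tvT // fE //; lia.
by apply/esym/negbTE; rewrite -leqNgt; apply: leq_trans hj; rewrite -mn mono //; lia.
Qed.

(** A semistandard tableau corresponds to the chain of shapes filled by its entries below [t], and
    the growth of the chain records its content. *)
Theorem schur_branching : schur n nu = schur_branch (mvar n) N n nu.
Proof.
rewrite schur_branch_chains /schur /skew_schur.
pose c (T : {ffun box nu [::] -> 'I_n}) := map (shape_lt T) (countdown n).
have -> : (\sum_(T : {ffun box nu [::] -> 'I_n} | semistandard T) \prod_b 'X_(T b) =
  \sum_(d <- map c [seq T <- enum {: {ffun box nu [::] -> 'I_n}} | semistandard T]) chain_weight (mvar n) n nu d)%R.
  rewrite big_map big_filter big_enum_cond /=; apply: eq_bigr => T sT.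
  by rewrite chain_weight_shape.
apply: perm_big; apply: uniq_perm; last 1 first.
- move=> d; apply/mapP/idP.
    case=> T; rewrite mem_filter => /andP[sT _] ->; apply/mem_branch_chains; exists (shape_lt T).
    by rewrite shape_lt_max // shape_lt0 //; split=> // t _; rewrite shape_lt_hstrip ?shape_lt_mem.
  case/mem_branch_chains => m [mn m0 -> mh]; have [T sT h] := chain_tableau mn m0 mh.
  exists T; first by rewrite mem_filter sT mem_enum.
  apply/eq_in_map => t td; rewrite h //.
  by elim: (n) td => //= k IH; rewrite inE => /predU1P[->//|/IH]; lia.
- rewrite map_inj_in_uniq; first exact: filter_uniq (enum_uniq _).
  move=> T T'; rewrite mem_filter => /andP[sT _]; rewrite mem_filter => /andP[sT' _] e.
  have E t : t < n -> shape_lt T t = shape_lt T' t.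
    rewrite /c in e; elim: (n) e => //= k IH [e1 e2]; rewrite ltnS leq_eqVlt => /predU1P[->//|].
    exact: IH.
  apply/ffunP => b; apply: val_inj; rewrite /= -!entryE.
  have hb : bcol b < pt nu (brow b) by rewrite -sk box_in.
  have Q t : t < n -> (entry T (brow b) (bcol b) < t) = (entry T' (brow b) (bcol b) < t).
    by move=> tn; have := shape_ltE sT t (brow b) (bcol b); rewrite E // shape_ltE // hb /=.
  have l1 := entry_lt T hb; have l2 := entry_lt T' hb.
  by have := Q _ l1; have := Q _ l2; rewrite !ltnn; lia.
- exact: branch_chains_uniq.
Qed.

End SchurBranching.

(** * Linear independence of Schur polynomials *)

Section Triangularity.

Variable n : nat.

Definition content_mon lam mu (T : {ffun box lam mu -> 'I_n}) : 'X_{1.. n} := (\sum_b U_(T b))%MM.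

Lemma content_monE lam mu (T : {ffun box lam mu -> 'I_n}) i : content_mon T i = \sum_b (T b == i).
Proof. by rewrite /content_mon mnm_sumE; apply: eq_bigr => b _; rewrite mnm1E. Qed.

Lemma prod_content_mon lam mu (T : {ffun box lam mu -> 'I_n}) :
  (\prod_b 'X_(T b) = 'X_[content_mon T] :> {mpoly int[n]})%R.
Proof. by rewrite /content_mon (big_morph _ (@mpolyXD n int) (mpolyX0 _ _)). Qed.

Lemma mcoeff_schur ka m : ((schur n ka)@_m)%R =
  (\sum_(T : {ffun box ka [::] -> 'I_n} | semistandard T) (content_mon T == m)%:R)%R.
Proof.
rewrite /schur /skew_schur raddf_sum /=; apply: eq_bigr => T _.
by rewrite prod_content_mon mcoeffX.
Qed.

Definition part_mon (s : seq nat) : 'X_{1.. n} := [multinom pt s i | i < n].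
Definition row_weight (s : seq nat) := \sum_(i < n) i * pt s i.

Lemma sum_brow ka : is_partition ka -> size ka <= n ->
  \sum_(b : box ka [::]) brow b = row_weight ka.
Proof.
move=> pk szk; rewrite (@big_box ka [::] pk _ _ _ (fun i _ => i)).
rewrite /row_weight -(big_mkord xpredT (fun i => i * pt ka i)) /index_iota subn0.
rewrite -(subnKC szk) iotaD big_cat /= [X in _ = _ + X]big1_seq ?addn0; last first.
  by move=> i; rewrite mem_iota add0n => /andP[_ /andP[h _]]; rewrite nth_default ?muln0.
apply: eq_bigr => i _; rewrite nth_nil subn0 big_const_seq count_predT size_iota.
by rewrite iter_addn_0 mulnC.
Qed.

Lemma sum_entries ka nu (T : {ffun box ka [::] -> 'I_n}) : content_mon T = part_mon nu ->
  \sum_b (T b : nat) = row_weight nu.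
Proof.
move=> e; rewrite /row_weight.
transitivity (\sum_(i < n) \sum_(b : box ka [::]) i * (T b == i)).
  rewrite exchange_big; apply: eq_bigr => b _ /=.
  rewrite (bigD1 (T b)) //= eqxx muln1 big1 ?addn0 // => i /negPf.
  by rewrite eq_sym => ->; rewrite muln0.
by apply: eq_bigr => i _; rewrite -big_distrr /= -content_monE e mnmE.
Qed.

Lemma brow_le ka (T : {ffun box ka [::] -> 'I_n}) b : is_partition ka -> semistandard T ->
  brow b <= T b.
Proof.
move=> pk sT; have [_ h2] := semistandardP pk _ sT.
rewrite -entryE; have := box_in b; rewrite /in_skew nth_nil /=.
elim: (brow b) => // i IH hi.
have hi' : bcol b < pt ka i by apply: leq_trans hi (part_step _ pk).
by apply: leq_ltn_trans (IH hi') _; apply: h2; rewrite // /in_skew nth_nil.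
Qed.

Lemma sum_leq_eq (I : finType) (F G : I -> nat) : (forall i, F i <= G i) ->
  \sum_i G i <= \sum_i F i -> forall i, F i = G i.
Proof.
move=> h s i; move: s; rewrite (bigD1 i) // [X in _ <= X](bigD1 i) //=.
have : \sum_(j | j != i) F j <= \sum_(j | j != i) G j by apply: leq_sum.
by move: (h i); lia.
Qed.

Lemma content_mon_row ka (T : {ffun box ka [::] -> 'I_n}) (i : 'I_n) : is_partition ka ->
  (forall b, brow b = T b) -> content_mon T i = pt ka i.
Proof.
move=> pk h; rewrite content_monE.
under eq_bigr => b _ do rewrite -val_eqE /= -h.
rewrite (@big_box ka [::] pk _ _ _ (fun r _ => (r == i :> nat) : nat)).
under eq_bigr => r _ do rewrite nth_nil subn0 big_const_seq count_predT size_iota iter_addn_0.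
case: (ltnP i (size ka)) => hi; last first.
  rewrite nth_default // big1_seq // => r /=; rewrite mem_iota add0n => /andP[_ hr].
  by case: eqP hr => [->|//]; lia.
rewrite (bigD1_seq (i : nat)) ?iota_uniq ?mem_iota //= eqxx mul1n.
by rewrite big1 ?addn0 // => r /negPf->.
Qed.

Lemma part_mon_inj s t : is_partition s -> is_partition t -> size s <= n -> size t <= n ->
  part_mon s = part_mon t -> s = t.
Proof.
move=> ps pt_ sn tn e; apply: part_ext => // i.
case: (ltnP i n) => hi; last by rewrite !nth_default //; lia.
by move/mnmP: e => /(_ (Ordinal hi)); rewrite !mnmE.
Qed.

(** Strict columns force entries in row [i] to be at least [i]. The row indices add up to
    [row_weight ka] and the entries to [row_weight nu]; equal totals leave only the filling of each
    row by its own index. *)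
Lemma triangular ka nu (T : {ffun box ka [::] -> 'I_n}) :
  is_partition ka -> is_partition nu -> size ka <= n -> size nu <= n ->
  semistandard T -> content_mon T = part_mon nu ->
  row_weight ka < row_weight nu \/ ka = nu /\ forall b, brow b = T b.
Proof.
move=> pk pn kn nun sT e.
have le b := brow_le b pk sT.
have [h|h] := ltnP (row_weight ka) (row_weight nu); [by left | right].
have E : forall b, brow b = T b.
  by apply: sum_leq_eq => //; rewrite (sum_entries e) sum_brow.
split=> //; apply: part_mon_inj => //; rewrite -e; apply/mnmP => i.
by rewrite mnmE content_mon_row.
Qed.

Lemma mcoeff_schur_diag nu : is_partition nu -> size nu <= n ->
  ((schur n nu)@_(part_mon nu) = 1)%R.
Proof.
move=> pn nun; rewrite mcoeff_schur.
have lt (b : box nu [::]) : brow b < n by apply: leq_trans nun; rewrite /brow.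
pose T0 : {ffun box nu [::] -> 'I_n} := [ffun b => Ordinal (lt b)].
have T0E b : T0 b = brow b :> nat by rewrite ffunE.
have sT0 : semistandard T0.
  apply/'forall_'forall_andP => b b'; by rewrite !T0E; split; apply/implyP => /andP[/eqP e lt']; rewrite // e.
rewrite (bigD1 T0) //= big1 ?addr0.
  have -> : content_mon T0 = part_mon nu by apply/mnmP => i; rewrite mnmE content_mon_row.
  by rewrite eqxx.
move=> T /andP[sT /eqP nT]; case: eqP => // e; case: nT.
case: (triangular pn pn nun nun sT e) => [|[_ h]]; first by rewrite ltnn.
by apply/ffunP => b; apply: val_inj; rewrite /= T0E h.
Qed.

Lemma mcoeff_schur_off ka nu : is_partition ka -> is_partition nu -> size ka <= n -> size nu <= n ->
  ka != nu -> row_weight nu <= row_weight ka -> ((schur n ka)@_(part_mon nu) = 0)%R.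
Proof.
move=> pk pn kn nun ne le; rewrite mcoeff_schur big1 // => T sT.
case: eqP => // e; case: (triangular pk pn kn nun sT e) => [|[e' _]]; first by rewrite ltnNge le.
by rewrite e' eqxx in ne.
Qed.

End Triangularity.

(** Induction on [row_weight]: in the coefficient of [part_mon N s], shapes of smaller weight have
    [d] zero already, and all others except [s] contribute nothing. [N] variables suffice because a
    partition of [N] has at most [N] parts. *)
Lemma schur_free N (d : seq nat -> int) :
  (\sum_(s <- partitions_le N | sumn s == N) d s *: schur N s = 0)%R ->
  forall s, is_partition s -> sumn s = N -> d s = 0%R.
Proof.
move=> h s; move: {2}(row_weight N s) (leqnn (row_weight N s)) => k.
elim/ltn_ind: k s => k IH s sk ps sN.
have sz t : is_partition t -> sumn t = N -> size t <= N by move=> pt' <-; apply: part_size_sumn.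
have sP : s \in partitions_le N by rewrite mem_partitions_le ps sN /=.
have := congr1 (mcoeff (part_mon N s)) h; rewrite raddf_sum /= mcoeff0.
rewrite big_mkcond (bigD1_seq s) ?partitions_le_uniq //= sN eqxx mcoeffZ mcoeff_schur_diag ?mulr1 //; last exact: sz.
rewrite big1_seq ?addr0 // => t /andP[ts /partitions_le_part pt'].
case: eqP => // tN; rewrite mcoeffZ; case: (ltnP (row_weight N t) (row_weight N s)) => le.
  by rewrite (IH (row_weight N t)) ?mul0r //; apply: leq_trans le sk.
by rewrite mcoeff_schur_off ?mulr0 //; apply: sz.
Qed.

(** * Ribbon tableaux as words *)

Section Words.

Variable n : nat.
Implicit Types (w u v : seq 'I_n).

Fixpoint words m : seq (seq 'I_n) :=
  if m is m'.+1 then [seq rcons w i | w <- words m', i <- enum 'I_n] else [:: [::]].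

Lemma mem_words m w : (w \in words m) = (size w == m).
Proof.
elim: m w => [|m IH] w /=; first by rewrite inE -size_eq0.
apply/allpairsPdep/eqP => [[u [i [hu _ ->]]]|].
  by rewrite size_rcons; move: hu; rewrite IH => /eqP->.
case/lastP: w => // u i; rewrite size_rcons => -[sz].
by exists u, i; rewrite IH sz eqxx mem_enum.
Qed.

Lemma size_words m : size (words m) = n ^ m.
Proof.
by elim: m => //= m IH; rewrite size_allpairs IH size_enum_ord expnSr.
Qed.

Lemma words_cat (V : nmodType) (F : seq 'I_n -> V) a m :
  (\sum_(w <- words (a + m)%N) F w = \sum_(u <- words a) \sum_(v <- words m) F (u ++ v))%R.
Proof.
elim: m F => [|m IH] F /=.
  by rewrite addn0; apply: eq_bigr => u _; rewrite big_seq1 cats0.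
rewrite addnS /= big_allpairs_dep IH; apply: eq_bigr => u _.
by rewrite big_allpairs_dep; apply: eq_bigr => v _; apply: eq_bigr => i _; rewrite rcons_cat.
Qed.

Definition word_mon w : {mpoly int[n]} := (\prod_(i <- w) 'X_i)%R.

Definition ord_le (i j : 'I_n) := i <= j.

Lemma hsym_rec k a : hsym (mvar n) k.+1 a.+1 = (hsym (mvar n) k a.+1 + mvar n k * hsym (mvar n) k.+1 a)%R.
Proof.
rewrite /= big_ord_recl expr0 mul1r subn0; congr (_ + _)%R.
rewrite big_distrr; apply: eq_bigr => j _ /=.
by rewrite /bump /= add1n exprS mulrA subSS.
Qed.

(** Words grow at the right end, where an increasing word has its largest letter. That letter is
    either [k], which may be stripped off, or smaller, which lowers the bound; this is the
    recurrence [hsym_rec]. *)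
Lemma hsym_words_lt k a : k <= n ->
  (\sum_(w <- words a | pairwise ord_le w && all (fun i : 'I_n => i < k)%N w) word_mon w = hsym (mvar n) k a)%R.
Proof.
elim: k a => [|k IHk] a kn.
  case: a => [|a] /=; first by rewrite big_mkcond big_seq1 /= /word_mon big_nil.
  rewrite big1_seq // => w /andP[/andP[_ h0]]; rewrite (mem_words a.+1).
  by case: w h0.
elim: a => [|a IHa].
  rewrite big_mkcond big_seq1 /= /word_mon big_nil big_ord1 expr0 mul1r subn0.
  by rewrite -(IHk 0) ?(ltnW kn) // big_mkcond big_seq1 /= /word_mon big_nil.
rewrite hsym_rec -IHa -(IHk a.+1) ?(ltnW kn) //.
rewrite big_mkcond [X in (_ = X + _)%R]big_mkcond [X in (_ = _ + _ * X)%R]big_mkcond /=.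
rewrite !big_allpairs_dep big_distrr -big_split /=; apply: eq_bigr => w _.
rewrite !big_enum /= (bigD1 (Ordinal kn)) //= [in RHS](bigD1 (Ordinal kn)) //=.
rewrite !all_rcons /= ltnSn ltnn !andbF add0r addrC; congr (_ + _)%R.
  apply: eq_bigr => i ik; rewrite !pairwise_rcons !all_rcons ltnS.
  have [ilt|] := boolP (i < k); last first.
    rewrite -leqNgt leq_eqVlt => /predU1P[h|h]; first by case/eqP: ik; apply: val_inj.
    by rewrite leqNgt h /= !andbF.
  rewrite (ltnW ilt) /=; congr (if _ then _ else _); rewrite -!andbA; case: (boolP (all _ w)) => //= hw.
  by congr (_ && _); apply/allP/allP => h j jw; have := allP hw j jw; rewrite /ord_le; lia.
rewrite pairwise_rcons /word_mon big_rcons /= -mvarE /= mulrC.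
have -> : all (ord_le^~ (Ordinal kn)) w = all (fun i : 'I_n => i < k.+1) w by [].
by case: (all _ w) (pairwise _ w) => -[] //=; rewrite mulr0.
Qed.

Lemma hsym_words a : (\sum_(w <- words a | pairwise ord_le w) word_mon w = hsym (mvar n) n a)%R.
Proof.
rewrite -hsym_words_lt //; apply: eq_bigl => w.
by rewrite (_ : all _ w) ?andbT //; apply/allP.
Qed.

(** Rows are read from bottom to top, each from left to right. In a shared column the largest entry
    of the lower row stands under the smallest entry of the upper row, so column strictness says
    that not every lower entry is at most every upper entry. *)
Fixpoint ribbon_word a (e : bool) (L : seq (nat * bool)) w : bool :=
  if L is (b, e') :: L' then
    [&& pairwise ord_le (take a w), e ==> ~~ allrel ord_le (take a w) (take b (drop a w))
      & ribbon_word b e' L' (drop a w)]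
  else pairwise ord_le w.

(** Two increasing rows that are comparable throughout form one increasing row. For the next overlap
    the lower row adds nothing: the middle row is nonempty as [0 < b], and comparability passes
    through it by transitivity. *)
Lemma ribbon_word_merge a b e L w : 0 < b -> size w = a + (b + sumn (unzip1 L)) ->
  ribbon_word a false ((b, e) :: L) w && allrel ord_le (take a w) (take b (drop a w)) = ribbon_word (a + b) e L w.
Proof.
move=> b0 sw /=.
have tE : take (a + b) w = take a w ++ take b (drop a w) by rewrite takeD.
have szv : size (take b (drop a w)) = b by rewrite size_take_min size_drop sw; lia.
case: L sw => [|[c e'] L] /= sw.
  rewrite -[X in _ = pairwise _ X](cat_take_drop a w) pairwise_cat.
  have -> : take b (drop a w) = drop a w by rewrite take_oversize // size_drop; lia.
  by rewrite /= andbC.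
rewrite tE pairwise_cat drop_drop (addnC b a) allrel_catl.
case: (boolP (allrel _ (take a w) (take b _))) => [al|]; last by rewrite !andbF.
rewrite /= andbT -!andbA; congr [&& _, _, _ ==> ~~ _ & _].
set z := take c _; case: (boolP (allrel ord_le (take b (drop a w)) z)) => h; rewrite ?andbF ?andbT //.
apply/esym/allrelP => i j hi hj.
have [k hk] : exists k, k \in take b (drop a w).
  by case: (take b (drop a w)) szv => [/= z0|k s _]; [by rewrite -z0 in b0 | exists k; rewrite inE eqxx].
by have /= := allrelP al i k hi hk; have := allrelP h k j hk hj; rewrite /ord_le; lia.
Qed.

Lemma ribbon_sum_words a e L : all (fun b => 0 < b.1) L ->
  (\sum_(w <- words (a + sumn (unzip1 L))%N | ribbon_word a e L w) word_mon w = ribbon_sum (mvar n) n a e L)%R.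
Proof.
elim: L a e => [|[b e'] L IH] a e /=; first by rewrite addn0 hsym_words.
case/andP=> b0 aL.
have E : (\sum_(w <- words (a + (b + sumn (unzip1 L)))%N | ribbon_word a false ((b, e') :: L) w) word_mon w =
          hsym (mvar n) n a * ribbon_sum (mvar n) n b e' L)%R.
  rewrite -IH // -hsym_words big_mkcond words_cat big_distrl /= [RHS]big_mkcond.
  rewrite big_seq [RHS]big_seq; apply: eq_bigr => u; rewrite mem_words => /eqP su.
  rewrite big_distrr /= [X in if _ then X else _]big_mkcond.
  have E v : ribbon_word a false ((b, e') :: L) (u ++ v) = pairwise ord_le u && ribbon_word b e' L v.
    by rewrite /= take_size_cat // drop_size_cat.
  case: (boolP (pairwise ord_le u)) => pu; last first.
    by rewrite big1 // => v _; have := E v; rewrite /= (negPf pu) => ->.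
  apply: eq_bigr => v _; have := E v; rewrite /= pu => ->; case: (ribbon_word _ _ _ _) => //=.
  by rewrite /word_mon big_cat.
case: e; last by rewrite subr0 -E.
rewrite -E -(IH (a + b)) // -addnA; apply/esym/eqP; rewrite subr_eq.
rewrite (bigID (fun w => allrel ord_le (take a w) (take b (drop a w)))) /= addrC; apply/eqP.
congr (_ + _)%R; first by apply: eq_bigl => w; rewrite -andbA; congr (_ && _); rewrite andbC.
rewrite big_seq_cond [RHS]big_seq_cond; apply: eq_bigl => w; rewrite mem_words.
by case: eqP => //= sw; rewrite -(ribbon_word_merge e' b0 sw).
Qed.

End Words.

(** * Ribbon diagrams and their reading words *)

Fixpoint rows_of (al : seq nat) (overlaps : nat -> bool) k : seq (nat * bool) :=
  if k is k'.+1 then (pt al k', (if k' is k''.+1 then overlaps k'' else false)) :: rows_of al overlaps k'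
  else [::].

Lemma count_range a b M : count (fun c => a <= c < b) (iota 0 M) = minn b M - a.
Proof.
elim: M => [|M IH]; first by rewrite minn0.
rewrite -addn1 iotaD count_cat IH /= add0n addn0; lia.
Qed.

Lemma shared_columnsE lam mu i j : is_partition lam -> is_partition mu -> i < j ->
  shared_columns lam mu i j = pt lam j - pt mu i.
Proof.
move=> pl pm ij; rewrite /shared_columns.
have h1 := part_mono pl (ltnW ij); have h2 := part_mono pm (ltnW ij).
have h3 : pt lam j <= pt lam 0 by apply: part_mono.
rewrite (@eq_count _ _ (fun c => pt mu i <= c < pt lam j)); last by move=> c; rewrite /in_skew; lia.
rewrite count_range; lia.
Qed.

Section RibbonWords.

Variables (n : nat) (al lam mu : seq nat).
Hypothesis rib_ : is_ribbon al lam mu.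
Hypothesis al0 : all (leq 1) al.

Let pl : is_partition lam. Proof. by case: rib_ => -[]. Qed.
Let pm : is_partition mu. Proof. by case: rib_ => -[]. Qed.
Let sz : size lam = size al. Proof. by case: rib_ => _ _ []. Qed.
Let alE i : pt lam i - pt mu i = pt al i. Proof. by case: rib_ => _ _ []. Qed.
Let mulam i : pt mu i <= pt lam i. Proof. by case: rib_ => -[]. Qed.

Definition overlaps i := pt mu i < pt lam i.+1.

Let ov1 i : pt lam i.+1 <= (pt mu i).+1.
Proof. by case: rib_ => _ _ _ /(_ i) + _; rewrite shared_columnsE //; lia. Qed.

Let far i j : i.+1 < j -> pt lam j <= pt mu i.
Proof. by move=> h; case: rib_ => _ _ _ _ /(_ i j h); rewrite shared_columnsE //; lia. Qed.

Definition row_boxes i : seq (box lam mu) :=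
  pmap (fun q => [pick b | coord b == q]) [seq (i, j) | j <- iota (pt mu i) (pt lam i - pt mu i)].

Lemma coord_row_boxes i : map (@coord _ _) (row_boxes i) = [seq (i, j) | j <- iota (pt mu i) (pt lam i - pt mu i)].
Proof.
rewrite /row_boxes; have : all (fun q => in_skew lam mu q.1 q.2)
    [seq (i, j) | j <- iota (pt mu i) (pt lam i - pt mu i)].
  apply/allP => q /mapP[j hj ->]; rewrite /in_skew /=; move: hj; rewrite mem_iota.
  by move: (mulam i); lia.
elim: [seq _ | _ <- _] => //= -[r c] s IH /andP[/= /(box_ex pl)[b eb] /IH e].
by case: pickP => [b' /eqP /= <-|/(_ b)]; [rewrite e | rewrite eb eqxx].
Qed.

Lemma size_row_boxes i : size (row_boxes i) = pt al i.
Proof. by rewrite -(size_map (@coord _ _)) coord_row_boxes size_map size_iota alE. Qed.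

Definition reading k : seq (box lam mu) := flatten [seq row_boxes i | i <- countdown k].

Lemma countdown_perm k : perm_eq (countdown k) (iota 0 k).
Proof.
elim: k => // k IH; have -> : iota 0 k.+1 = rcons (iota 0 k) k by rewrite -addn1 iotaD cats1.
by rewrite perm_sym perm_rcons perm_cons perm_sym.
Qed.

Lemma reading_perm : perm_eq (reading (size lam)) (enum {: box lam mu}).
Proof.
apply: (@perm_map_inj _ _ (@coord lam mu)); first exact: coord_inj.
rewrite perm_sym (permPl (cells_perm mu pl (countdown_perm _))) /cells /reading map_flatten -map_comp.
by rewrite (@eq_map _ _ (map (@coord lam mu) \o row_boxes) _ coord_row_boxes).
Qed.

Variable T : {ffun box lam mu -> 'I_n}.

Let rowT i := map T (row_boxes i).

Let mem_rowT i x : x \in rowT i <-> exists2 j, in_skew lam mu i j & entry T i j = x.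
Proof.
split.
  case/mapP=> b hb ->; exists (bcol b).
    have : coord b \in map (@coord _ _) (row_boxes i) by apply: map_f.
    by rewrite coord_row_boxes => /mapP[j _ [<- _]]; apply: box_in.
  have : coord b \in map (@coord _ _) (row_boxes i) by apply: map_f.
  by rewrite coord_row_boxes => /mapP[j _ [<- _]]; rewrite entryE.
case=> j hj; have [b eb] := box_ex pl hj; rewrite (entry_coord _ eb) => /val_inj <-.
apply: map_f; have : coord b \in map (@coord _ _) (row_boxes i).
  rewrite coord_row_boxes eb; apply: map_f; rewrite mem_iota; move: hj; rewrite /in_skew; lia.
by rewrite (mem_map (@coord_inj lam mu)).
Qed.

Let rowT_val i : map val (rowT i) = [seq entry T i j | j <- iota (pt mu i) (pt lam i - pt mu i)].
Proof.
rewrite -map_comp; transitivity (map (fun q => entry T q.1 q.2) (map (@coord _ _) (row_boxes i))).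
  by rewrite -map_comp; apply: eq_map => b /=; rewrite entryE.
by rewrite coord_row_boxes -map_comp.
Qed.

Let rowT_pw i : pairwise (@ord_le n) (rowT i) <->
  forall j j', in_skew lam mu i j -> in_skew lam mu i j' -> j < j' -> entry T i j <= entry T i j'.
Proof.
have -> : pairwise (@ord_le n) (rowT i) = pairwise leq (map val (rowT i)) by rewrite pairwise_map.
rewrite rowT_val pairwise_map; split.
  move=> /(pairwiseP 0) h j j'; rewrite /in_skew => hj hj' jj'.
  have := h (j - pt mu i) (j' - pt mu i); rewrite !inE size_iota.
  by rewrite !nth_iota ?subnKC; try lia; apply; lia.
move=> h; apply/(pairwiseP 0) => j j'; rewrite !inE size_iota => hj hj' jj'.
by rewrite !nth_iota //=; apply: h; rewrite /in_skew; lia.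
Qed.

Let rw_rows k : k < size al ->
  ribbon_word (pt al k) (if k is k'.+1 then overlaps k' else false) (rows_of al overlaps k) (map T (reading k.+1)) <->
  (forall i, i <= k -> pairwise (@ord_le n) (rowT i)) /\
  (forall i, i < k -> overlaps i -> ~~ allrel (@ord_le n) (rowT i.+1) (rowT i)).
Proof.
elim: k => [|k IH] hk.
  rewrite /= /reading /= cats0; split=> [h|[h _]]; last exact: h.
  by split=> // i; rewrite leqn0 => /eqP->.
have {IH} IH := IH (ltnW hk).
have E : map T (reading k.+2) = rowT k.+1 ++ (rowT k ++ map T (reading k)).
  by rewrite /reading /= !map_cat.
have s1 : size (rowT k.+1) = pt al k.+1 by rewrite size_map size_row_boxes.
have s2 : size (rowT k) = pt al k by rewrite size_map size_row_boxes.
rewrite E /= take_size_cat // drop_size_cat // take_size_cat //.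
have E' : map T (reading k.+1) = rowT k ++ map T (reading k) by rewrite /reading /= !map_cat.
rewrite -E'; split.
  case/and3P=> h1 /implyP h2 /IH[h3 h4]; split=> i.
    by rewrite leq_eqVlt => /predU1P[->//|]; rewrite ltnS; apply: h3.
  by rewrite ltnS leq_eqVlt => /predU1P[->//|]; apply: h4.
case=> h1 h2; apply/and3P; split; [exact: h1 | by apply/implyP; apply: h2 |].
by apply/IH; split=> i hi; [apply: h1|apply: h2]; lia.
Qed.

Lemma semistandard_ribbon_word k : size al = k.+1 ->
  semistandard T = ribbon_word (pt al k) (if k is k'.+1 then overlaps k' else false) (rows_of al overlaps k)
                     (map T (reading k.+1)).
Proof.
move=> szk; have kk : k < size al by rewrite szk.
apply/(semistandardP pl)/idP => [[h1 h2]|/(rw_rows kk)[h1 h2]].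
  apply/(rw_rows kk); split=> i hi; first by apply/rowT_pw => j j'; apply: h1.
  move=> oi; apply/negP => /allrelP al_.
  have p1 : 0 < pt al i.+1 by apply: (all_nthP 0 al0); lia.
  have p2 : 0 < pt al i by apply: (all_nthP 0 al0); lia.
  have k1 : in_skew lam mu i (pt mu i) by move: (alE i); rewrite /in_skew; lia.
  have k2 : in_skew lam mu i.+1 (pt mu i).
    by rewrite /in_skew; move: oi (part_step i pm); rewrite /overlaps; lia.
  have [b1 e1] := box_ex pl k1; have [b2 e2] := box_ex pl k2.
  have := h2 i i.+1 (pt mu i) k1 k2 (ltnSn i); rewrite (entry_coord _ e1) (entry_coord _ e2) => lt.
  have := al_ (T b2) (T b1); rewrite /ord_le leqNgt lt => H.
  have : false by apply: H; apply/mem_rowT; [exists (pt mu i) | exists (pt mu i)]; rewrite // ?(entry_coord _ e1) ?(entry_coord _ e2).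
  by [].
have rowin i j : in_skew lam mu i j -> i <= k.
  by move=> /andP[_ h]; have := pt_gt0 i pl; rewrite sz szk; lia.
have mono i j j' : in_skew lam mu i j -> in_skew lam mu i j' -> j <= j' -> entry T i j <= entry T i j'.
  move=> hj hj'; rewrite leq_eqVlt => /predU1P[->//|]; move: j j' hj hj'.
  move=> j j' hj hj'; apply: (rowT_pw i).1 => //; apply: h1; exact: rowin hj.
split=> [i j j' hj hj' jj'|i i' j hj hj' ii']; first by apply: mono => //; apply: ltnW.
have ii : i' = i.+1.
  by case: (ltngtP i' i.+1) => //; [lia | move/far; move: hj hj'; rewrite /in_skew; lia].
(* The shared column ends row [i.+1] and begins row [i], so any violating pair of entries bounds the
   two entries of that column from the right sides. *)
rewrite ii in hj' *; have jm : j = pt mu i by move: hj hj' (ov1 i); rewrite /in_skew; lia.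
have oi : overlaps i by move: hj'; rewrite /overlaps /in_skew; lia.
have ik : i < k by have := rowin _ _ hj'.
have := h2 i ik oi => /allPn[x /mem_rowT[j1 h11 e1] /allPn[y /mem_rowT[j2 h21 e2]]].
rewrite /ord_le -ltnNge -e1 -e2 => lt.
have l1 : entry T i.+1 j1 <= entry T i.+1 j.
  by apply: mono => //; move: h11 hj' (ov1 i); rewrite /in_skew; lia.
have l2 : entry T i j <= entry T i j2 by apply: mono => //; move: h21; rewrite /in_skew; lia.
by lia.
Qed.

End RibbonWords.

Lemma sumn_rows_of al overlaps k : sumn (unzip1 (rows_of al overlaps k)) = sumn (take k al).
Proof.
elim: k => [|k IH]; first by rewrite take0.
rewrite /= IH; case: (ltnP k (size al)) => hk.
  by rewrite (take_nth 0) // sumn_rcons addnC.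
by rewrite nth_default // !take_oversize // ltnW.
Qed.

Lemma last_rows_of al overlaps k :
  last (if k is k'.+1 then overlaps k' else false) (unzip2 (rows_of al overlaps k)) = false.
Proof. by elim: k => //= k IH; case: k IH. Qed.

Lemma all_rows_of al overlaps k : k <= size al -> all (leq 1) al -> all (fun b => 0 < b.1) (rows_of al overlaps k).
Proof.
move=> + al0; elim: k => //= k IH hk; rewrite IH ?(ltnW hk) // andbT.
by apply: (all_nthP 0 al0).
Qed.

Section RibbonSchur.

Variables (al lam mu : seq nat).
Hypothesis hrib : is_ribbon al lam mu.
Hypothesis al0 : all (leq 1) al.

Let N := sumn al.
Let L := rows_of al (overlaps lam mu) (size al).

Lemma ribbon_sumn : sumn lam = sumn mu + sumn al.
Proof.
case: hrib => -[_ _ h] _ [_ alE] _ _.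
pose M := size lam + size mu + size al.
rewrite (@sumn_nth lam M) ?(@sumn_nth mu M) ?(@sumn_nth al M); try by rewrite /M; lia.
by rewrite -big_split; apply: eq_bigr => i _ /=; rewrite -alE subnKC.
Qed.

Let szl : size lam = size al.
Proof. by case: hrib => _ _ []. Qed.

Lemma size_reading k : size (reading lam mu k) = sumn (take k al).
Proof.
rewrite -(sumn_rows_of al (overlaps lam mu)); elim: k => //= k IH.
by rewrite -IH /reading /= size_cat (size_row_boxes hrib).
Qed.

Lemma skew_schur_ribbon_sum n k : size al = k.+1 -> skew_schur n lam mu =
  ribbon_sum (mvar n) n (pt al k) (if k is k'.+1 then overlaps lam mu k' else false) (rows_of al (overlaps lam mu) k).
Proof.
move=> szk; rewrite -ribbon_sum_words; last by apply: all_rows_of => //; rewrite szk.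
have sN : pt al k + sumn (unzip1 (rows_of al (overlaps lam mu) k)) = size (reading lam mu (size lam)).
  by rewrite size_reading szl szk -(sumn_rows_of al (overlaps lam mu)).
rewrite sN /skew_schur.
pose wd (T : {ffun box lam mu -> 'I_n}) := map T (reading lam mu (size lam)).
have bp := reading_perm hrib al0.
transitivity (\sum_(w <- map wd (enum {: {ffun box lam mu -> 'I_n}}) |
   ribbon_word (pt al k) (if k is k'.+1 then overlaps lam mu k' else false) (rows_of al (overlaps lam mu) k) w) word_mon w)%R.
  rewrite big_map big_enum_cond /=; apply: eq_big => T.
    by rewrite (semistandard_ribbon_word hrib al0 T szk) /wd szl szk.
  by move=> _; rewrite /word_mon big_map (perm_big _ bp) big_enum.
apply: perm_big.
have wd_inj : injective wd.
  move=> T T' /eq_in_map e; apply/ffunP => b; apply: e.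
  by rewrite (perm_mem bp) mem_enum.
have u1 : uniq (map wd (enum {: {ffun box lam mu -> 'I_n}})).
  by rewrite (map_inj_uniq wd_inj) enum_uniq.
have sub : {subset map wd (enum {: {ffun box lam mu -> 'I_n}}) <= words n (size (reading lam mu (size lam)))}.
  by move=> w /mapP[T _ ->]; rewrite mem_words size_map.
(* Reading is injective and there are as many fillings as words, so every word is the reading of a
   filling. *)
have le : size (words n (size (reading lam mu (size lam)))) <= size (map wd (enum {: {ffun box lam mu -> 'I_n}})).
  by rewrite size_words size_map -cardE card_ffun card_ord (perm_size bp) -cardE.
apply: uniq_perm => //; first exact: leq_size_uniq u1 sub le.
by case: (uniq_min_size u1 sub le).
Qed.

Lemma ribbon_schur_expansion : schur_expansion lam mu (fun s => (chain_count N L s)%:Z%R).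
Proof.
have NE : sumn lam - sumn mu = N by rewrite ribbon_sumn addKn.
rewrite /schur_expansion NE => n.
have -> := @sum_partitions_le _ N (fun s => (chain_count N L s)%:Z *: schur n s)%R.
rewrite /L; case szk : (size al) => [|k].
  have l0 : lam = [::] by apply: size0nil; rewrite szl.
  have m0 : mu = [::].
    case: hrib => -[_ pm h] _ _ _ _; apply: part_sumn0 => //.
    by have := sum_le_sub h; rewrite l0 /=; lia.
  have N0 : N = 0 by rewrite /N (size0nil szk).
  rewrite l0 m0 N0 big_mkcond (bigD1_seq [::]) ?partitions_le_uniq ?mem_partitions_le //= chain_count_nil eqxx scale1r.
  rewrite big1_seq ?addr0 // => s /andP[/negPf s0 _].
  by rewrite chain_count_nil s0 scale0r if_same.
rewrite (skew_schur_ribbon_sum n szk).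
have sN : pt al k + sumn (unzip1 (rows_of al (overlaps lam mu) k)) = N.
  by have := sumn_rows_of al (overlaps lam mu) k.+1; rewrite /= -szk take_size.
rewrite (@ribbon_sum_expand _ _ N) ?sN //.
- rewrite big_seq_cond [RHS]big_seq_cond; apply: eq_bigr => s /andP[+ _].
  rewrite mem_partitions_le => /andP[ps sN'].
  by rewrite (schur_branching n ps sN') mulr_natl -[Posz _]natz scaler_nat.
- by apply: all_rows_of => //; rewrite szk.
- by rewrite last_rows_of.
Qed.

(** The chosen function is an expansion because chain counts provide one; in [N] variables the
    difference of the two is zero by [schur_free]. *)
Lemma lr_coef_ribbon nu : is_partition nu -> sumn nu = sumn al ->
  lr_coef lam mu nu = (chain_count N L nu)%:Z%R.
Proof.
move=> pn sn; have NE : sumn lam - sumn mu = N by rewrite ribbon_sumn addKn.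
have h2 := ribbon_schur_expansion.
have h1 : schur_expansion lam mu (lr_coef lam mu).
  by apply: (@epsilon_spec _ (inhabits (fun=> 0%R)) (schur_expansion lam mu)); exists (fun s => (chain_count N L s)%:Z%R).
apply/eqP; rewrite -subr_eq0; apply/eqP.
apply: (@schur_free N (fun s => lr_coef lam mu s - (chain_count N L s)%:Z)%R) => //.
have := h1 N; rewrite h2 NE.
have -> := @sum_partitions_le _ N (fun s => (chain_count N L s)%:Z *: schur N s)%R.
have -> := @sum_partitions_le _ N (fun s => lr_coef lam mu s *: schur N s)%R.
move=> e; rewrite (eq_bigr (fun s => lr_coef lam mu s *: schur N s - (chain_count N L s)%:Z *: schur N s)%R).
  by rewrite sumrB e subrr.
by move=> s _; rewrite scalerBl.
Qed.

End RibbonSchur.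

(** * Standard tableaux *)

Section Refine.

Variables l r : seq nat.
Hypotheses (pl : is_partition l) (pr : is_partition r) (hlr : hstrip l r).

Definition strip_tail k := tl l k - tl r k.

Lemma strip_tailE k : strip_tail k + pt r k = pt l k + strip_tail k.+1.
Proof.
have sub := hstrip_sub hlr.
by rewrite /strip_tail; move: (tailE l k) (tailE r k) (tail_sub k sub) (tail_sub k.+1 sub) (sub k); lia.
Qed.

Lemma strip_tail_step k : strip_tail k.+1 <= strip_tail k.
Proof. by move: (strip_tailE k) (hstrip_sub hlr k); lia. Qed.

Lemma strip_tail_mono k j : k <= j -> strip_tail j <= strip_tail k.
Proof.
elim: j => [|j IH]; first by rewrite leqn0 => /eqP->.
by rewrite leq_eqVlt => /predU1P[->//|/IH]; apply: leq_trans; apply: strip_tail_step.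
Qed.

Lemma nth_bottom_boxes b i : pt (bottom_boxes l r b) i = pt r i + minn b (strip_tail i) - minn b (strip_tail i.+1).
Proof.
apply: nth_part_of => [k|k hk]; rewrite -!/(strip_tail _).
  have := strip_tailE k; have := strip_tailE k.+1; have := strip_tail_step k; have := strip_tail_step k.+1.
  by move/hstripP: hlr => /(_ k); move: (hstrip_sub hlr k.+1); lia.
rewrite /strip_tail !drop_oversize ?nth_default //; try lia;
have := hstrip_size hlr pl pr; lia.
Qed.

Lemma part_bottom_boxes b : is_partition (bottom_boxes l r b).
Proof.
apply: part_of_part => k; rewrite -!/(strip_tail _).
have := strip_tailE k; have := strip_tailE k.+1; have := strip_tail_step k; have := strip_tail_step k.+1.
by move/hstripP: hlr => /(_ k); move: (hstrip_sub hlr k.+1); lia.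
Qed.

Lemma bottom_boxes0 : bottom_boxes l r 0 = r.
Proof.
apply: part_ext => // [|i]; first exact: part_bottom_boxes.
by rewrite nth_bottom_boxes !min0n addn0 subn0.
Qed.

Lemma strip_tail0 : strip_tail 0 = sumn l - sumn r.
Proof. by rewrite /strip_tail !drop0. Qed.

Lemma bottom_boxes_full a : sumn l = sumn r + a -> bottom_boxes l r a = l.
Proof.
move=> e; apply: part_ext => // [|i]; first exact: part_bottom_boxes.
have := strip_tailE i; have := strip_tail_mono (leq0n i); have := strip_tail_mono (leq0n i.+1).
by rewrite nth_bottom_boxes strip_tail0; move: (strip_tail_step i); lia.
Qed.

Lemma bottom_boxes_hstrip b : hstrip (bottom_boxes l r b.+1) (bottom_boxes l r b).
Proof.
apply/hstripP => i; rewrite !nth_bottom_boxes.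
have := strip_tailE i; have := strip_tailE i.+1; have := strip_tail_step i; have := strip_tail_step i.+1.
by move/hstripP: hlr => /(_ i); move: (hstrip_sub hlr i.+1); lia.
Qed.

Lemma sumn_bottom_boxes b : sumn r + b <= sumn l -> sumn (bottom_boxes l r b) = sumn r + b.
Proof.
move=> h; have e : sumn l = sumn r + (sumn l - sumn r - b) + b by lia.
by have [] := bottom_boxes_spec pl pr hlr e.
Qed.

Lemma bottom_boxes_row b i : pt (bottom_boxes l r b) i < pt (bottom_boxes l r b.+1) i <-> strip_tail i.+1 <= b < strip_tail i.
Proof. rewrite !nth_bottom_boxes; move: (strip_tail_step i); split; lia. Qed.

End Refine.

Lemma ribbon_chain_sumn L l r : ribbon_chain L l r -> sumn l = sumn (unzip1 L).
Proof.
elim: L l r => [|[a e] L IH] l r /=; first by case=> ->.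
by case=> _ _ -> [s /IH-> _]; rewrite addnC.
Qed.

Lemma sumn_take_lt al q k : all (leq 1) al -> q < k -> k <= size al ->
  sumn (take q al) < sumn (take k al).
Proof.
move=> al0; elim: k => // k IH qk hk.
rewrite (take_nth 0) // sumn_rcons; have := all_nthP 0 al0 k hk.
by move: qk; rewrite ltnS leq_eqVlt => /predU1P[->|/IH /(_ (ltnW hk))]; lia.
Qed.

(** Each strip is filled box by box from its lowest row upwards, so no descent occurs inside it. The
    clause on [bottom_boxes] keeps track of how the last strip was filled, which is needed to
    compare its last box with the first box of the next strip. *)
Theorem refine_chain al k l r (L := rows_of al (fun=> true) k) : all (leq 1) al -> k <= size al ->
  is_partition l -> ribbon_chain L l r ->
  exists m : nat -> seq nat,
    [/\ m 0 = [::], m (sumn l) = l,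
        forall t, t < sumn l -> [/\ hstrip (m t.+1) (m t), is_partition (m t) & sumn (m t) = t],
        0 < k -> forall b, sumn r + b <= sumn l -> m (sumn r + b) = bottom_boxes l r b
      & forall t i j, t.+1 < sumn l -> pt (m t) i < pt (m t.+1) i ->
          pt (m t.+1) j < pt (m t.+2) j ->
          (i < j) = (t.+1 \in [seq sumn (take q al) | q <- iota 1 k.-1])].
Proof.
move=> al0; rewrite {}/L; elim: k l r => [|k IH] l r hk pl.
  by case=> -> _; exists (fun=> [::]); split.
case=> pr hlr sl [s Cs es].
have [m [m0 mr mh mm mD]] := IH r s (ltnW hk) pr Cs.
have sr : sumn r = sumn (take k al) by rewrite (ribbon_chain_sumn Cs) sumn_rows_of.
have a1 : 0 < pt al k by apply: (all_nthP 0 al0).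
pose m2 t := if t <= sumn r then m t else bottom_boxes l r (t - sumn r).
have mle t : t <= sumn r -> m2 t = m t by rewrite /m2 => ->.
have mge b : m2 (sumn r + b) = bottom_boxes l r b.
  rewrite /m2; case: leqP => h; last by rewrite addKn.
  have -> : b = 0 by lia.
  by rewrite addn0 mr bottom_boxes0.
exists m2; split.
- by rewrite mle.
- by rewrite sl mge bottom_boxes_full.
- move=> t tl_; case: (ltnP t (sumn r)) => h.
    by rewrite !mle ?(ltnW h) //; apply: mh.
  rewrite -(subnKC h) -addnS !mge; split; first exact: bottom_boxes_hstrip.
    exact: part_bottom_boxes.
  by apply: sumn_bottom_boxes => //; lia.
- by move=> _ b _; rewrite mge.
move=> t i j tl_; case: (ltnP t (sumn r)) => h; last first.
  rewrite -(subnKC h) -!addnS !mge => /(bottom_boxes_row pl pr hlr) h1 /(bottom_boxes_row pl pr hlr) h2.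
  have ij : j <= i.
    rewrite leqNgt; apply/negP => ij; have := strip_tail_mono pl pr hlr ij; lia.
  rewrite ltnNge ij /=; apply/esym/negbTE/mapP => -[q].
  rewrite mem_iota => hq e; have : sumn (take q al) <= sumn r; last by lia.
  rewrite sr; case: (ltngtP q k) => [qk|qk|->//]; last by lia.
  exact: ltnW (sumn_take_lt al0 qk (ltnW hk)).
rewrite (mle t (ltnW h)) (mle t.+1 h); move: (h); rewrite leq_eqVlt => /predU1P[tr|tr]; last first.
  rewrite mle // => h1 h2; rewrite (mD t i j tr h1 h2).
  apply/mapP/mapP => -[q]; rewrite mem_iota => hq e; exists q => //; rewrite mem_iota; first lia.
  have : q != k by apply/eqP => qk; move: e; rewrite qk -sr; lia.
  by lia.
have k0 : 0 < k by case: (k) sr tr => // sr tr; move: tr; rewrite sr take0.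
have [ps hrs sE] : [/\ is_partition s, hstrip r s & sumn r = sumn s + pt al k.-1].
  by case: (k) k0 Cs => // k' _ [].
have a2 : 0 < pt al k.-1 by apply: (all_nthP 0 al0); lia.
(* The remaining case is the boundary: step [t] adds the last box of [r/s] and step [t.+1] the first
   box of [l/r]. These lie in the highest row of [r/s] and the lowest row of [l/r], which are at
   least as far apart as the rows of the given descent. *)
have tE : t = sumn s + (pt al k.-1).-1 by lia.
have tE' : t.+1 = sumn s + (pt al k.-1).-1.+1 by lia.
rewrite {1}tE {1}tE' !(mm k0); try lia.
move=> /(bottom_boxes_row pr ps hrs) h1.
have -> : t.+2 = sumn r + 1 by lia.
rewrite mge tr mr -{1}(bottom_boxes0 pl pr hlr) => /(bottom_boxes_row pl pr hlr) h2.
have /strip_descentP[i0 [j0 [ij hi hj]]] : strip_descent l r s by apply: es; case: (k) k0.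
have ii : i <= i0.
  rewrite leqNgt; apply/negP => lt; have := strip_tail_mono pr ps hrs lt; have := strip_tailE pr ps hrs i0.
  have := strip_tail0 r s; have := strip_tail_mono pr ps hrs (leq0n i0); lia.
have jj : j0 <= j.
  rewrite leqNgt; apply/negP => lt; have := strip_tail_mono pl pr hlr lt; have := strip_tailE pl pr hlr j0; lia.
rewrite (leq_ltn_trans ii (leq_trans ij jj)); apply/esym/mapP; exists k; last by [].
by rewrite mem_iota; lia.
Qed.

Lemma standard_semistandard nu (U : {ffun box nu [::] -> 'I_(sumn nu)}) :
  standard U -> semistandard U.
Proof.
case/andP=> _ /'forall_'forall_andP h; apply/'forall_'forall_andP => b b'.
have [/implyP h1 h2] := h b b'; split=> //.
by apply/implyP => /h1; apply: ltnW.
Qed.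

Section StandardTableaux.

Variables (al nu : seq nat).
Hypotheses (pnu : is_partition nu) (al0 : all (leq 1) al) (sal : sumn nu = sumn al).

Let sg k := sumn (take k al).

Let sgm k k' : k <= k' -> k' <= size al -> sg k <= sg k'.
Proof. by rewrite leq_eqVlt => /predU1P[->//|h h']; apply: ltnW; apply: sumn_take_lt. Qed.

Lemma card_box : #|{: box nu [::]}| = sumn nu.
Proof.
rewrite -sum1_card (@big_box nu [::] pnu _ _ _ (fun _ _ => 1)).
rewrite (@sumn_nth nu (size nu)) // -(big_mkord xpredT (fun i => pt nu i)) /index_iota subn0.
by apply: eq_bigr => i _; rewrite sum1_size size_iota nth_nil subn0.
Qed.

Lemma sum_ord_lt n t : \sum_(i < n) (i < t) = minn t n.
Proof.
elim: n => [|n IH]; first by rewrite big_ord0 minn0.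
by rewrite big_ord_recr /= IH; lia.
Qed.

Lemma partial_sumsP t : reflect (exists2 q, 0 < q < size al & t = sg q) (t \in partial_sums al).
Proof.
apply: (iffP mapP) => -[q]; rewrite ?mem_iota => hq ->; exists q => //; first lia.
by rewrite mem_iota; lia.
Qed.

Section FromTableau.

Variable U : {ffun box nu [::] -> 'I_(sumn nu)}.
Hypotheses (sU : standard U) (dU : descent_set U =i partial_sums al).

Let injU : injective U. Proof. by case/andP: sU => /injectiveP. Qed.

Let ssU : semistandard U := standard_semistandard sU.

Let onto t : t < sumn nu -> exists b, U b = t :> nat.
Proof.
move=> h; have : Ordinal h \in codom U.
  by apply: inj_card_onto => //; rewrite card_ord card_box.
by case/codomP => b e; exists b; rewrite -e.
Qed.

Let size_shp t : t <= sumn nu -> sumn (shape_lt U t) = t.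
Proof.
move=> h; rewrite (sumn_shape_lt pnu (leqnn _) ssU).
have [g Ug gU] : bijective U by apply: inj_card_bij => //; rewrite card_ord card_box.
rewrite (reindex g) /=; last by exists U => i _; rewrite ?Ug ?gU.
rewrite (eq_bigr (fun i : 'I_(sumn nu) => (i < t : nat))); first by rewrite sum_ord_lt; lia.
by move=> i _; rewrite gU.
Qed.

Let nondesc b b' : U b' = (U b).+1 :> nat -> (U b).+1 \notin partial_sums al -> brow b' <= brow b.
Proof.
move=> e; rewrite -dU => h; rewrite leqNgt; apply: contra h => lt.
by apply/existsP; exists b; apply/existsP; exists b'; rewrite eqxx e eqxx.
Qed.

Let rows_decr b b' : U b <= U b' ->
  (forall t, U b < t <= U b' -> t \notin partial_sums al) -> brow b' <= brow b.
Proof.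
move: {2}(U b' - U b) (erefl (U b' - U b)) => d; elim: d b' => [|d IH] b' dE le h.
  by have -> : b' = b by apply: injU; apply: ord_inj; lia.
have lt : (U b').-1 < sumn nu by have := ltn_ord (U b'); lia.
have [b2 e2] := onto lt.
apply: (@leq_trans (brow b2)).
  apply: nondesc; first by lia.
  by apply: h; lia.
by apply: IH; [lia | lia | move=> t ht; apply: h; lia].
Qed.

Let in_shp b t : (bcol b < pt (shape_lt U t) (brow b)) = (U b < t).
Proof.
rewrite (shape_ltE pnu ssU) entryE; have := box_in b; rewrite /in_skew nth_nil /= => ->.
by [].
Qed.

Let sgN : sg (size al) = sumn nu. Proof. by rewrite /sg take_size. Qed.

(** Labels between consecutive partial sums move weakly upwards, so two of them in one column are
    impossible. At a partial sum, the descent of [U] supplies the two rows for [strip_descent]. *)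
Lemma tableau_chain k : k <= size al ->
  ribbon_chain (rows_of al xpredT k) (shape_lt U (sg k)) (shape_lt U (sg k.-1)).
Proof.
elim: k => [|k IH] hk; first by rewrite /= /sg take0 (shape_lt0 pnu ssU).
have sgS : sg k.+1 = sg k + pt al k by rewrite /sg (take_nth 0) // sumn_rcons addnC.
have sgk : sg k.+1 <= sumn nu by rewrite -sgN sgm.
have a0 : 0 < pt al k by apply: (all_nthP 0 al0).
split.
- exact: part_shape_lt.
- apply/hstripP => i /=; apply/andP; split; last first.
    rewrite leqNgt; apply/negP; rewrite (shape_ltE pnu ssU) => /andP[h1 h2].
    by have := shape_ltE pnu ssU (sg k.+1) i (pt (shape_lt U (sg k.+1)) i); rewrite ltnn h1 /=; lia.
  rewrite leqNgt; apply/negP => lt; set j := pt (shape_lt U (sg k)) i in lt.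
  have := lt; rewrite (shape_ltE pnu ssU) => /andP[j1 h1].
  have j2 : j < pt nu i by apply: leq_trans j1 (part_step i pnu).
  have h2 : sg k <= entry U i j.
    by have := shape_ltE pnu ssU (sg k) i j; rewrite j2 /= -/j ltnn; lia.
  have [b eb] : exists b : box nu [::], coord b = (i, j) by apply: box_ex; rewrite // /in_skew nth_nil.
  have [b' eb'] : exists b : box nu [::], coord b = (i.+1, j).
    by apply: box_ex; rewrite // /in_skew nth_nil.
  rewrite (entry_coord _ eb) in h2; rewrite (entry_coord _ eb') in h1.
  have [_ cs] := semistandardP pnu _ ssU.
  have := cs i i.+1 j; rewrite /in_skew nth_nil j1 j2 ltnSn => /(_ isT isT isT).
  rewrite (entry_coord _ eb) (entry_coord _ eb') => bb.
  have : brow b' <= brow b.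
    apply: rows_decr; first exact: ltnW.
    move=> t ht; apply/partial_sumsP => -[q hq tq].
    have [qk|kq] := leqP q k; first by have := sgm qk (ltnW hk); lia.
    by have := sgm kq (_ : q <= size al); lia.
  by case: eb => -> _; case: eb' => -> _; rewrite ltnn.
- rewrite !size_shp //=; lia.
exists (shape_lt U (sg k.-1)); first by apply: IH; apply: ltnW.
case: k hk {IH} sgS sgk a0 => // k hk sgS sgk a0 _ /=; apply/strip_descentP.
have sgS' : sg k.+1 = sg k + pt al k by rewrite /sg (take_nth 0) ?sumn_rcons 1?addnC //; lia.
have a1 : 0 < pt al k by apply: (all_nthP 0 al0); lia.
have hin : sg k.+1 \in partial_sums al by apply/partial_sumsP; exists k.+1.
rewrite -dU in hin; have /existsP[b /existsP[b' /and3P[/eqP e1 /eqP e2 lt]]] := hin.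
exists (brow b), (brow b'); split=> //.
  have := in_shp b (sg k.+1); have := in_shp b (sg k); lia.
have := in_shp b' (sg k.+2); have := in_shp b' (sg k.+1); lia.
Qed.

End FromTableau.

Lemma chain_standard r : ribbon_chain (rows_of al xpredT (size al)) nu r ->
  exists U : {ffun box nu [::] -> 'I_(sumn nu)}, standard U /\ descent_set U =i partial_sums al.
Proof.
move=> Cr; have [m [m0 mn mh _ mD]] := refine_chain al0 (leqnn _) pnu Cr.
have [|U ssU sh] := @chain_tableau (sumn nu) (sumn nu) nu pnu (leqnn _) m mn m0.
  by move=> t /[dup] tn /mh[-> pm sm]; rewrite mem_partitions_le pm sm ltnW.
have shE t : t <= sumn nu -> shape_lt U t = m t.
  by rewrite leq_eqVlt => /predU1P[->|/sh//]; rewrite mn (shape_lt_max pnu ssU).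
have sm t : t <= sumn nu -> sumn (m t) = t.
  by rewrite leq_eqVlt => /predU1P[->|/mh[]//]; rewrite mn.
(* The shapes grow by one box at a time, so each label occurs exactly once. *)
have one t : t < sumn nu -> \sum_b (U b == t :> nat) = 1.
  move=> tn; have h1 := sumn_shape_lt pnu (leqnn _) ssU t; have h2 := sumn_shape_lt pnu (leqnn _) ssU t.+1.
  rewrite shE ?sm // in h2; rewrite shE ?sm ?(ltnW tn) // in h1.
  have E : \sum_b (U b < t.+1) = \sum_b (U b < t) + \sum_b (U b == t :> nat).
    rewrite -big_split; apply: eq_bigr => b _ /=.
    by rewrite ltnS leq_eqVlt; case: eqP => [->|_]; rewrite ?ltnn ?addn0.
  lia.
have injU : injective U.
  move=> b b' e; have := one (U b) (ltn_ord _); rewrite (bigD1 b) //= eqxx.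
  have [//|ne] := eqVneq b b'; rewrite (bigD1 b') 1?eq_sym //= e eqxx; lia.
have onto t : t < sumn nu -> exists b, U b = t :> nat.
  move=> tn; have := one t tn; case: (pickP (fun b => U b == t :> nat)) => [b /eqP e _|h].
    by exists b.
  by rewrite big1 // => b _; rewrite h.
have at_ b : pt (m (U b)) (brow b) < pt (m (U b).+1) (brow b).
  have := shape_ltE pnu ssU (U b) (brow b) (bcol b); have := shape_ltE pnu ssU (U b).+1 (brow b) (bcol b).
  rewrite !entryE !shE ?(ltnW (ltn_ord _)) //; have := box_in b; rewrite /in_skew nth_nil /= => ->.
  by rewrite ltnn ltnSn /=; lia.
have D b b' : U b' = (U b).+1 :> nat -> (brow b < brow b') = ((U b).+1 \in partial_sums al).
  move=> e; have := at_ b; have := at_ b'; rewrite e => h1 h2.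
  by apply: mD => //; rewrite -e.
exists U; split.
  apply/andP; split; first exact/injectiveP.
  have /'forall_'forall_andP h := ssU; apply/'forall_'forall_andP => b b'.
  have [/implyP h1 h2] := h b b'; split=> //; apply/implyP => /[dup] hb /h1 le.
  rewrite ltn_neqAle le andbT; apply/eqP => /val_inj /injU e.
  by move: hb; rewrite e ltnn andbF.
move=> i; apply/existsP/idP.
  case=> b /existsP[b' /and3P[/eqP e1 /eqP e2 lt]].
  have e : U b' = (U b).+1 :> nat by lia.
  by move: (D b b' e); rewrite lt e1 => <-.
move=> /[dup] hi /partial_sumsP[q hq iq].
have q0 : 0 < q by lia.
have qs : q < size al by lia.
have i0 : 0 < i by rewrite iq; have := sumn_take_lt al0 q0 (ltnW qs); rewrite take0.
have iN : i < sumn nu.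
  by rewrite sal iq; have := sumn_take_lt al0 qs (leqnn _); rewrite take_size.
have i1 : i.-1 < sumn nu by lia.
have [b eb] := onto _ i1; have [b' eb'] := onto i iN.
exists b; apply/existsP; exists b'; rewrite eb eb' eqxx prednK // eqxx /=.
by rewrite D eb ?eb' prednK.
Qed.

End StandardTableaux.

(** * The conditions on the shape *)

Lemma size_rows_of al overlaps k : size (rows_of al overlaps k) = k.
Proof. by elim: k => //= k ->. Qed.

Lemma rows_tail_of al overlaps k i : k <= size al -> rows_tail (rows_of al overlaps k) i = tl (take k al) i.
Proof.
elim: k => [|k IH] hk; first by rewrite take0.
rewrite /= size_rows_of IH ?(ltnW hk) // (take_nth 0) //.
have sz : size (take k al) = k by rewrite size_takel // ltnW.
case: leqP => h; last by rewrite drop_oversize // size_rcons sz.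
by rewrite drop_rcons ?sz // sumn_rcons addnC.
Qed.

Lemma overlaps_tail_of al overlaps k i : overlaps_tail (rows_of al overlaps k) i = \sum_(i <= j < k.-1) overlaps j.
Proof.
elim: k => [|k IH]; first by rewrite big_geq.
rewrite /= size_rows_of IH; case: ltnP => h; last by rewrite big_geq.
by case: k h {IH} => // k h; rewrite big_nat_recr //= addnC.
Qed.

Lemma ordered_rows_of al overlaps k : k <= size al -> is_partition al -> all (leq 2) al -> ordered_rows (rows_of al overlaps k).
Proof.
move=> + pal al2; elim: k => // k IH hk /=.
rewrite (IH (ltnW hk)) andbT; apply/andP; split; first exact: (all_nthP 0 al2).
by case: k hk {IH} => //= k hk; apply: part_step.
Qed.

Lemma eq_rows_of al overlaps overlaps' k : (forall i, i.+1 < k -> overlaps i = overlaps' i) -> rows_of al overlaps k = rows_of al overlaps' k.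
Proof.
elim: k => //= k IH h; rewrite IH; last by move=> i hi; apply: h; lia.
by case: k h {IH} => // k h; rewrite h.
Qed.

Lemma part_conj s c : is_partition s ->
  exists2 r, r <= size s & forall i, (c < pt s i) = (i < r).
Proof.
move=> ps; exists (count (fun r => c < pt s r) (iota 0 (size s))).
  by rewrite -{2}(size_iota 0 (size s)) count_size.
move=> i; rewrite count_down; last by move=> j h; apply: leq_trans h (part_step j ps).
by have := pt_gt0 i ps; case: ltnP => //=; lia.
Qed.

Section Overlaps.

Variables (al lam mu : seq nat).
Hypothesis hrib : is_ribbon al lam mu.

Let pl : is_partition lam. Proof. by case: hrib => -[]. Qed.
Let pm : is_partition mu. Proof. by case: hrib => -[]. Qed.
Let szl : size lam = size al. Proof. by case: hrib => _ _ []. Qed.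

(** The rows meeting column [c] form the interval from [r0] to [r1], of at most two rows; such a
    column has length two exactly when it carries one overlap. *)
Lemma column_overlap c i : i < size lam ->
  (column_length lam mu c == 2) && all (fun r => ~~ in_skew lam mu r c) (iota 0 i) =
  \sum_(i <= j < (size lam).-1) (in_skew lam mu j c && in_skew lam mu j.+1 c) :> nat.
Proof.
move=> hi; have [r1 r1l e1] := part_conj c pl; have [r0 r0m e0] := part_conj c pm.
have iE r : in_skew lam mu r c = (r0 <= r < r1).
  by rewrite /in_skew e1 leqNgt e0 -leqNgt.
have far : r1 <= r0.+2.
  rewrite leqNgt; apply/negP => h.
  case: hrib => _ _ _ _ /(_ r0 r0.+2 (ltnSn _)); rewrite shared_columnsE //.
  by have := e1 r0.+2; have := e0 r0; rewrite h ltnn; lia.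
have -> : column_length lam mu c = minn r1 (size lam) - r0.
  by rewrite /column_length (eq_count iE) count_range.
have -> : all (fun r => ~~ in_skew lam mu r c) (iota 0 i) = (minn r1 i - r0 == 0).
  rewrite -count_range -(eq_count iE) -leqn0 leqNgt -has_count -all_predC.
  by apply: eq_all.
have -> : \sum_(i <= j < (size lam).-1) (in_skew lam mu j c && in_skew lam mu j.+1 c) =
    count (fun j => maxn i r0 <= j < r1.-1) (iota 0 (size lam).-1).
  rewrite -sum1_count [RHS]big_mkcond /= (big_nat_widenl _ 0) //.
  rewrite /index_iota subn0 big_mkcond; apply: eq_bigr => j _.
  by rewrite !iE geq_max; case: (leqP i j) => //= h; case: ifP; lia.
rewrite count_range; lia.
Qed.

Lemma nth_overlap i : pt (overlapping_partition lam mu) i = overlaps_tail (rows_of al (overlaps lam mu) (size al)) i.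
Proof.
rewrite overlaps_tail_of -szl; case: (ltnP i (size lam)) => hi; last first.
  rewrite nth_default ?size_map ?size_iota // big_geq //; lia.
rewrite (nth_map 0) ?size_iota // nth_iota // add0n -sum1_count big_mkcond /=.
rewrite (eq_bigr (fun c => \sum_(i <= j < (size lam).-1) (in_skew lam mu j c && in_skew lam mu j.+1 c))).
  rewrite exchange_big; apply: eq_bigr => j _ /=.
  have -> : overlaps lam mu j = shared_columns lam mu j j.+1 :> nat.
    case: hrib => _ _ _ /(_ j); rewrite /overlaps shared_columnsE //; lia.
  by rewrite /shared_columns -sum1_count [RHS]big_mkcond; apply: eq_bigr => c _; case: (_ && _).
by move=> c _; rewrite -column_overlap //; case: (_ && _).
Qed.

End Overlaps.

Section Conditions.

Variables (al lam mu nu : seq nat).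
Hypotheses (pal : is_partition al) (al2 : all (leq 2) al) (hrib : is_ribbon al lam mu).
Hypotheses (pnu : is_partition nu) (snu : sumn nu = sumn al).

Let L := rows_of al (overlaps lam mu) (size al).
Let p := overlapping_partition lam mu.

Let AE i : rows_tail L i = tl al i. Proof. by rewrite rows_tail_of // take_size. Qed.
Let pE i : pt p i = overlaps_tail L i. Proof. exact: nth_overlap. Qed.
Let wL : ordered_rows L. Proof. exact: ordered_rows_of. Qed.
Let szl : size lam = size al. Proof. by case: hrib => _ _ []. Qed.

Let PP_mono i : overlaps_tail L i.+1 <= overlaps_tail L i.
Proof.
rewrite !overlaps_tail_of; have [h|h] := ltnP i (size al).-1; last by rewrite !big_geq // ltnW.
by rewrite [X in _ <= X]big_ltn // leq_addl.
Qed.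

Let nz i : (i < nonzero_parts p) = (0 < overlaps_tail L i).
Proof.
have szp : size p = size lam by rewrite size_map size_iota.
have -> : nonzero_parts p = count (fun i => 0 < overlaps_tail L i) (iota 0 (size lam)).
  rewrite /nonzero_parts -[p](mkseq_nth 0) count_map szp.
  by apply: eq_count => j /=; rewrite pE.
rewrite count_down; last by move=> j h; apply: leq_trans h (PP_mono j).
case: ltnP => //= h; rewrite overlaps_tail_size // size_rows_of -szl; lia.
Qed.

(** Dominance over [al] passes to complementary tails. Against the two-row partition only the first
    partial sum matters, and it is the bound for row 0. Where [overlaps_tail L k] is zero the row
    bound is contained in the tail bound; elsewhere [overlaps_rows_tail] ensures that the
    subtraction is not truncated. *)
Lemma conditionsE : ribbon_conditions al p nu <->
  (forall k, tl nu k <= rows_tail L k) /\ (forall k, pt nu k + overlaps_tail L k <= rows_tail L k).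
Proof.
have PA i := overlaps_rows_tail i wL.
have dom : (forall k, sumn (take k al) <= sumn (take k nu)) <-> (forall k, tl nu k <= rows_tail L k).
  have E k : (sumn (take k al) <= sumn (take k nu)) = (tl nu k <= rows_tail L k).
    rewrite AE; have := snu; rewrite -{1}(cat_take_drop k nu) -{1}(cat_take_drop k al) !sumn_cat; lia.
  by split=> h k; [rewrite -E | rewrite E].
split.
  case=> -[_ /dom h1] _ h3; split=> // k.
  have [k0|k0] := posnP (overlaps_tail L k).
    by rewrite k0 addn0; apply: leq_trans (h1 k); rewrite tailE leq_addr.
  by have := h3 k; rewrite nz k0 => /(_ isT); rewrite pE -AE; have := PA k; lia.
case=> h1 h2; have pS : pt p 0 <= sumn al.
  by rewrite pE; have := PA 0; rewrite AE drop0.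
split.
- by split; [rewrite snu | apply/dom].
- split; first by rewrite /= addn0 subnK.
  case=> [|[|k]]; rewrite ?take0 //.
    have -> : sumn (take 1 nu) = pt nu 0 by case: (nu) => //= x s; rewrite take0 /= addn0.
    by have := h2 0; rewrite AE drop0 -pE /=; lia.
  apply: (@leq_trans (sumn nu)); last by rewrite /= addn0 subnK ?snu.
  by rewrite -{2}(cat_take_drop k.+2 nu) sumn_cat leq_addr.
- by move=> i; rewrite nz pE -AE => _; have := h2 i; lia.
Qed.

Lemma chain_iff_conditions : (exists m, ribbon_chain L nu m) <-> ribbon_conditions al p nu.
Proof.
rewrite conditionsE; split.
  case=> m Cm; have [_ _ h] := ribbon_chain_tail Cm pnu; split=> // k.
  by have [] := ribbon_chain_row k wL pnu Cm.
case=> h1 h2; have s0 : sumn nu = rows_tail L 0 by rewrite AE drop0.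
by have [//|r Cr _] := @chain_exists L nu false wL pnu s0 h1 h2; exists r.
Qed.

End Conditions.

Theorem theorem1p5 (alpha lam mu p nu : seq nat)
  (halpha : is_partition alpha)
  (halpha2 : all (leq 2) alpha)
  (hribbon : is_ribbon alpha lam mu)
  (hp : p = overlapping_partition lam mu)
  (hnu : is_partition nu)
  (hsize : sumn nu = sumn alpha) :
  ((0 < lr_coef lam mu nu)%R <-> ribbon_conditions alpha p nu) /\
  (nonzero_parts p = (size alpha).-1 ->
   (forall i : nat, i < size alpha -> nth 0 p i = size alpha - i.+1) ->
   ((exists U : {ffun box nu [::] -> 'I_(sumn nu)},
       standard U /\ descent_set U =i partial_sums alpha)
    <-> ribbon_conditions alpha p nu)).
Proof.
have alpha1 : all (leq 1) alpha by apply: sub_all halpha2 => x; apply: ltnW.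
have iffC := chain_iff_conditions halpha halpha2 hribbon hnu hsize.
rewrite hp; split.
  rewrite -iffC (lr_coef_ribbon hribbon alpha1 hnu hsize) -(chain_count_gt0 _ hnu (_ : _ <= sumn alpha)) ?hsize //.
move=> _ pfull.
(* Consecutive entries of the overlapping partition differ by the overlap between the two rows, and
   here by one. *)
have full i : i.+1 < size alpha -> overlaps lam mu i = true.
  move=> hi; have h1 := pfull i (ltnW hi); have h2 := pfull i.+1 hi.
  rewrite !(nth_overlap hribbon) !overlaps_tail_of in h1 h2.
  by move: h1; rewrite big_ltn ?h2; [case: (overlaps _ _ _) => //; lia | lia].
rewrite -iffC (@eq_rows_of alpha _ xpredT _ full); split.
  case=> U [sU dU]; exists (shape_lt U (sumn (take (size alpha).-1 alpha))).
  have := tableau_chain hnu alpha1 hsize sU dU (leqnn _).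
  by rewrite take_size -{1}hsize shape_lt_max //; apply: standard_semistandard.
by case=> r; apply: chain_standard.
Qed.
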